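(* Let $\theta>0$, $h>0$, and let $B=\mathcal{C}([0,h])$ be the Banach space of real-valued continuous functions on $[0,h]$ with the supremum norm. Let $\{\xi_t,\ t\in\mathbb{R}\}$ be the Ornstein-Uhlenbeck process with parameter $\theta$, and for each integer $n\ge 1$ let $\widehat{\theta}_n$ be the maximum likelihood estimator of $\theta$ based on the observation of $\xi$ on $[0,T]$ with $T=nh$. Then the estimator $\rho_{\widehat{\theta}_n}$ of the operator $\rho_\theta$ is strongly consistent in the norm of $\mathcal{L}(B)$, i.e. $$\|\rho_\theta-\rho_{\widehat{\theta}_n}\|_{\mathcal{L}(B)}\longrightarrow 0\quad\text{almost surely, as } n\to\infty.$$
   Context: $W=\{W_t,\ t\in\mathbb{R}\}$ is a standard bilateral (two-sided) Wiener process on a probability space $(\Omega,\mathcal{A},\mathcal{P})$. The Ornstein-Uhlenbeck (O.U.) process with parameter $\theta>0$ is the zero-mean stationary Gaussian process with continuous sample paths $\xi_t=\int_{-\infty}^{t}e^{-\theta(t-s)}\,dW_s$, $t\in\mathbb{R}$ (covariance $\frac{1}{2\theta}e^{-\theta|t-s|}$). $\mathcal{L}(B)$ is the space of bounded linear operators on $B$ with the operator norm. For a real number $u$, the operator $\rho_u$ is defined by $\rho_u(x)(t)=e^{-ut}x(h)$, $0\le t\le h$, $x\in B$. In particular $\rho_{\widehat{\theta}_n}(x)(t)=e^{-\widehat{\theta}_n t}x(h)$. The maximum likelihood estimator of $\theta$ based on $\{\xi_t,\ t\in[0,T]\}$ is $$\widehat{\theta}_T=\frac{1+\frac{\xi_0^2}{T}-\frac{\xi_T^2}{T}}{\frac{2}{T}\int_0^T\xi_t^2\,dt},\quad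 T>0,$$ and $\widehat{\theta}_n$ denotes this estimator with $T=nh$. *)

(* Defs.v *)
(* MathComp-Analysis, over an arbitrary [R : realType]. *)
From HB Require Import structures.
From mathcomp Require Import all_boot all_order all_algebra.
From mathcomp Require Import all_classical all_reals all_analysis.

Set Implicit Arguments.
Unset Strict Implicit.
Unset Printing Implicit Defensive.

Import Order.TTheory GRing.Theory Num.Theory.
Import numFieldNormedType.Exports.

Local Open Scope classical_set_scope.
Local Open Scope ring_scope.

Section sup_range.
Context {R : realType} {T : Type}.
Implicit Types f g : T -> R.

Lemma range_sup_ge f t : has_ubound (range f) -> f t <= sup (range f).
Proof. by move=> ub; apply: ub_le_sup => //; exists t. Qed.

Lemma range_sup_le f (M : R) :
  0 <= M -> (forall t, f t <= M) -> sup (range f) <= M.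
Proof.
move=> M0 fM; have [->|ne] := eqVneq (range f) set0; first by rewrite sup0.
by apply: ge_sup; [exact/set0P | move=> _ [t _ <-]].
Qed.

Lemma range_sup_ge0 f : (forall t, 0 <= f t) -> 0 <= sup (range f).
Proof.
move=> f0; have [[[_ [t _ _]] ub]|/sup_out->//] := pselect (has_sup (range f)).
exact: le_trans (f0 t) (range_sup_ge _ ub).
Qed.
End sup_range.

(** * The space C([0, h]) with the supremum norm *)

Section cont_pred.
Context {R : realType} {T : topologicalType}.

Definition cont_pred : {pred T -> R^o} :=
  mem [set x : T -> R^o | continuous x].

Lemma cont_pred_submod_closed : submod_closed cont_pred.
Proof.
split; first by rewrite inE /= => t; exact: cvg_cst.
move=> a f g; rewrite !inE /= => cf cg t.
by apply: cvgD; [apply: cvgZl_tmp; exact: cf | exact: cg].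
Qed.

HB.instance Definition _ :=
  GRing.isSubmodClosed.Build R (T -> R^o) cont_pred cont_pred_submod_closed.
End cont_pred.

(* The set [`[0, h]%classic] is coerced to the type of its points, which carries
   the induced topology. *)
Record C0 (R : realType) (h : R) := MkC0 {
  C0_fun :> `[0, h]%classic -> R^o;
  C0_subproof : C0_fun \in cont_pred }.

HB.instance Definition _ (R : realType) (h : R) := [isSub for @C0_fun R h].
HB.instance Definition _ (R : realType) (h : R) := [Choice of C0 h by <:].
HB.instance Definition _ (R : realType) (h : R) :=
  [SubChoice_isSubLmodule of C0 h by <:].

Section C0_norm.
Context {R : realType} {h : R}.
Implicit Types x y : C0 h.

Lemma C0_continuous x : continuous (x : `[0, h]%classic -> R^o).
Proof. by have := C0_subproof x; rewrite inE. Qed.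

Lemma C0_eqP x y : (forall t, x t = y t) -> x = y.
Proof. by move=> xy; apply/val_inj/funext => t; exact: xy. Qed.

Definition C0_norm x : R := sup (range (fun t => `|x t|)).

Lemma C0_has_ubound x : has_ubound (range (fun t => `|x t|)).
Proof.
have /subspace_valL_continuousP cx := @C0_continuous x.
have /compact_bounded[M [_ /(_ (M + 1))]] :=
  continuous_compact cx (@segment_compact R 0 h).
rewrite ltrDl ltr01 => /(_ isT) xM; exists (M + 1) => _ [t _ <-].
apply: xM; exists (\val t); first by have := set_valP t.
exact: (congr1 (fun f : `[0, h]%classic -> R^o => f t) (valLK point x)).
Qed.

Lemma C0_norm_ge x t : `|x t| <= C0_norm x.
Proof. exact: (range_sup_ge t (C0_has_ubound x)). Qed.

Lemma C0_norm_ge0 x : 0 <= C0_norm x.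
Proof. exact: range_sup_ge0. Qed.

Lemma C0_normD x y : C0_norm (x + y) <= C0_norm x + C0_norm y.
Proof.
apply: range_sup_le => [|t]; first by rewrite addr_ge0 ?C0_norm_ge0.
by rewrite (le_trans (ler_normD _ _))// lerD ?C0_norm_ge.
Qed.

Lemma C0_normZ (a : R) x : C0_norm (a *: x) = `|a| * C0_norm x.
Proof.
have le b z : C0_norm (b *: z) <= `|b| * C0_norm z.
  apply: range_sup_le => [|t]; first by rewrite mulr_ge0 ?C0_norm_ge0.
  by rewrite [`|_|]normrM ler_wpM2l ?C0_norm_ge.
have [->|a0] := eqVneq a 0.
  by apply/eqP; rewrite eq_le le normr0 mul0r C0_norm_ge0.
apply/eqP; rewrite eq_le le /= -ler_pdivlMl ?normr_gt0// -normfV.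
by rewrite -{1}[x](scalerK a0) le.
Qed.

Lemma C0_norm_eq0 x : C0_norm x = 0 -> x = 0.
Proof.
move=> x0; apply: C0_eqP => t.
by apply/eqP; rewrite -normr_le0 -x0 C0_norm_ge.
Qed.
End C0_norm.

HB.instance Definition _ (R : realType) (h : R) :=
  Lmodule_isNormed.Build R (C0 h) C0_normD C0_normZ C0_norm_eq0.

(** * Bounded linear operators with the operator norm *)

Section blin_pred.
Context {R : realType} {V W : normedModType R}.

Definition blin_pred : {pred V -> W} :=
  mem [set f : V -> W | linear f /\ exists M : R, forall x, `|f x| <= M * `|x|].

Lemma blin_pred_submod_closed : submod_closed blin_pred.
Proof.
split.
  rewrite inE /=; split; first by move=> a x y; rewrite scaler0 addr0.
  by exists 0 => x; rewrite normr0 mul0r.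
move=> a f g; rewrite !inE /= => -[lf [M fM]] [lg [N gN]]; split.
  move=> b x y; rewrite !fctE lf lg !scalerDr !scalerA (mulrC a).
  by rewrite addrACA.
exists (`|a| * M + N) => x; rewrite mulrDl -mulrA.
by rewrite (le_trans (ler_normD _ _))// lerD// [leLHS]normrZ ler_wpM2l.
Qed.

HB.instance Definition _ :=
  GRing.isSubmodClosed.Build R (V -> W) blin_pred blin_pred_submod_closed.
End blin_pred.

Record blin (R : realType) (V W : normedModType R) := MkBlin {
  blin_fun :> V -> W;
  blin_subproof : blin_fun \in blin_pred }.

HB.instance Definition _ (R : realType) (V W : normedModType R) :=
  [isSub for @blin_fun R V W].
HB.instance Definition _ (R : realType) (V W : normedModType R) :=
  [Choice of blin V W by <:].
HB.instance Definition _ (R : realType) (V W : normedModType R) :=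
  [SubChoice_isSubLmodule of blin V W by <:].

Section blin_norm.
Context {R : realType} {V W : normedModType R}.
Implicit Types f g : blin V W.

Lemma blin_linear f : linear (f : V -> W).
Proof. by have := blin_subproof f; rewrite inE => -[]. Qed.

Lemma blin0 f : f 0 = 0.
Proof.
have := @blin_linear f 1 0 0; rewrite !scale1r addr0.
by move/(congr1 (fun z => z - f 0)); rewrite subrr addrK.
Qed.

Lemma blinZ f (a : R) x : f (a *: x) = a *: f x.
Proof. by rewrite -[a *: x]addr0 blin_linear blin0 addr0. Qed.

Lemma blin_eqP f g : (forall x, f x = g x) -> f = g.
Proof. by move=> fg; apply/val_inj/funext => x; exact: fg. Qed.

Definition op_norm f : R := sup [set `|f x| | x in [set x : V | `|x| <= 1]].

Lemma op_norm_has_ubound f :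
  has_ubound [set `|f x| | x in [set x : V | `|x| <= 1]].
Proof.
have := blin_subproof f; rewrite inE => -[_ [M fM]].
exists `|M| => _ [x /= x1 <-]; rewrite (le_trans (fM x))//.
by rewrite (le_trans (ler_norm _))// normrM normr_id ler_piMr.
Qed.

Lemma op_norm_ge1 f x : `|x| <= 1 -> `|f x| <= op_norm f.
Proof.
by move=> x1; apply: ub_le_sup; [exact: op_norm_has_ubound | exists x].
Qed.

Lemma op_norm_le f (M : R) :
  (forall x, `|x| <= 1 -> `|f x| <= M) -> op_norm f <= M.
Proof.
move=> fM; apply: ge_sup; last by move=> _ [x x1 <-]; exact: fM.
by exists `|f 0|; exists 0 => //=; rewrite normr0.
Qed.

Lemma op_norm_ge0 f : 0 <= op_norm f.
Proof. by rewrite (le_trans _ (@op_norm_ge1 f 0 _)) ?normr0. Qed.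

Lemma op_normP f x : `|f x| <= op_norm f * `|x|.
Proof.
have [->|x0] := eqVneq x 0.
  by rewrite blin0 !normr0 mulr0.
have nx : 0 < `|x| by rewrite normr_gt0.
rewrite -ler_pdivrMr// mulrC -[in X in X * _](normr_id x) -normfV -normrZ -blinZ.
by apply: op_norm_ge1; rewrite normrZ normfV normr_id mulVf ?gt_eqF.
Qed.

Lemma op_normD f g : op_norm (f + g) <= op_norm f + op_norm g.
Proof.
apply: op_norm_le => x x1.
by rewrite (le_trans (ler_normD _ _))// lerD ?op_norm_ge1.
Qed.

Lemma op_normZ (a : R) f : op_norm (a *: f) = `|a| * op_norm f.
Proof.
have le b g : op_norm (b *: g) <= `|b| * op_norm g.
  by apply: op_norm_le => x x1; rewrite [leLHS]normrZ ler_wpM2l ?op_norm_ge1.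
have [->|a0] := eqVneq a 0.
  by apply/eqP; rewrite eq_le le normr0 mul0r op_norm_ge0.
apply/eqP; rewrite eq_le le /= -ler_pdivlMl ?normr_gt0// -normfV.
by rewrite -{1}[f](scalerK a0) le.
Qed.

Lemma op_norm_eq0 f : op_norm f = 0 -> f = 0.
Proof.
move=> f0; apply: blin_eqP => x.
by apply/eqP; rewrite -normr_le0 (le_trans (op_normP f x))// f0 mul0r.
Qed.
End blin_norm.

HB.instance Definition _ (R : realType) (V W : normedModType R) :=
  Lmodule_isNormed.Build R (blin V W) op_normD op_normZ op_norm_eq0.

(** * The operators rho_u *)

Section rho.
Context {R : realType} {h : R}.
Hypothesis h0 : 0 < h.

Lemma rho_endpoint : h \in `[0, h]%classic.
Proof. by apply/mem_set; rewrite /= in_itv /= lexx (ltW h0). Qed.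

Definition rho_fun (u : R) (x : C0 h) : `[0, h]%classic -> R^o :=
  fun t => expR (- u * \val t) * x (SigSub rho_endpoint).

Lemma rho_fun_cont u x : rho_fun u x \in cont_pred.
Proof.
apply/mem_set => t; apply: (@cvgM _ _ (nbhs t)); last exact: cvg_cst.
apply: (@continuous_comp _ _ _ (fun s : `[0, h]%classic => - u * \val s) expR);
  last exact: continuous_expR.
by apply: (@cvgM _ _ (nbhs t)); [exact: cvg_cst | exact: initial_continuous].
Qed.

Definition rho_op (u : R) (x : C0 h) : C0 h := MkC0 (rho_fun_cont u x).

Lemma rho_op_blin u : rho_op u \in blin_pred.
Proof.
rewrite inE /=; split.
  move=> a x y; apply: C0_eqP => t /=; rewrite /rho_fun.
  by rewrite [LHS]mulrDr mulrCA.
exists (expR (`|u| * h)) => x; apply: range_sup_le => [|t].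
  by rewrite mulr_ge0 ?expR_ge0 ?C0_norm_ge0.
rewrite [`|_|]normrM ler_pM ?C0_norm_ge// ger0_norm ?expR_ge0// ler_expR.
have := set_valP t; rewrite /= in_itv /= => /andP[t0 th].
rewrite (le_trans (ler_norm _))// normrM normrN (ger0_norm t0).
by rewrite ler_wpM2l.
Qed.

Definition rho (u : R) : blin (C0 h) (C0 h) := MkBlin (rho_op_blin u).
End rho.

(** * Two-sided Wiener process *)

Definition mutually_independent d (T : measurableType d) (R : realType)
    (P : probability T R) (n : nat) (X : 'I_n -> T -> R) : Prop :=
  forall A : 'I_n -> set R, (forall i, measurable (A i)) ->
    P [set w | forall i, A i (X i w)] = (\prod_(i < n) P (X i @^-1` A i))%E.

Record standard_wiener d (T : measurableType d) (R : realType)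
    (P : probability T R) (W : R -> {RV P >-> R}) : Prop := {
  wiener0 : {ae P, forall w, W 0 w = 0};
  wiener_indep : forall (n : nat) (t : nat -> R), (forall i, t i < t i.+1) ->
    mutually_independent P (fun (i : 'I_n) w => W (t i.+1) w - W (t i) w);
  wiener_normal : forall s t : R, s < t -> forall A : set R, measurable A ->
    P ((fun w => W t w - W s w) @^-1` A) = normal_prob 0 (Num.sqrt (t - s)) A;
  wiener_continuous : {ae P, forall w, continuous (fun t => W t w)} }.

(** * Wiener integral of a deterministic square-integrable function *)

(* The step function worth [step_coef i] on
   ]step_knot i, step_knot i.+1], i < step_size, and 0 elsewhere. *)
Record step_fun (R : realType) := StepFun {
  step_size : nat;
  step_knot : nat -> R;
  step_coef : nat -> R;
  step_knot_nd : forall i, step_knot i <= step_knot i.+1 }.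

Definition step_eval (R : realType) (phi : step_fun R) (s : R) : R :=
  \sum_(i < step_size phi)
    step_coef phi i * \1_`]step_knot phi i, step_knot phi i.+1] s.

Definition step_integral (T : Type) (R : realType) (W : R -> T -> R)
    (phi : step_fun R) (w : T) : R :=
  \sum_(i < step_size phi)
    step_coef phi i * (W (step_knot phi i.+1) w - W (step_knot phi i) w).

(* [X] is (a version of) the integral of [f] against [dW] over the whole line:
   the L^2(P)-limit of the integrals of step functions converging to [f] in
   L^2(R).  By the isometry property the limit does not depend on the
   approximating sequence. *)
Definition is_wiener_integral d (T : measurableType d) (R : realType)
    (P : probability T R) (W : R -> {RV P >-> R}) (f : R -> R)
    (X : {RV P >-> R}) : Prop :=
  exists phi : nat -> step_fun R,
    ((\int[lebesgue_measure]_s ((f s - step_eval (phi n) s) ^+ 2)%:E)%E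
       @[n --> \oo] --> 0%E) /\
    ((\int[P]_w ((X w - step_integral W (phi n) w) ^+ 2)%:E)%E
       @[n --> \oo] --> 0%E).

(** * Ornstein-Uhlenbeck process and maximum likelihood estimator *)

Definition ou_kernel (R : realType) (theta t : R) : R -> R :=
  fun s => expR (- theta * (t - s)) * \1_`]-oo, t] s.

Record ornstein_uhlenbeck d (T : measurableType d) (R : realType)
    (P : probability T R) (W : R -> {RV P >-> R}) (theta : R)
    (xi : R -> {RV P >-> R}) : Prop := {
  ou_integral : forall t, is_wiener_integral W (ou_kernel theta t) (xi t);
  ou_continuous : {ae P, forall w, continuous (fun t => xi t w)} }.

(* A function of the observed path [x], restricted to [0, S]. *)
Definition mle (R : realType) (x : R -> R) (S : R) : R :=
  (1 + x 0 ^+ 2 / S - x S ^+ 2 / S) /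
  (2 / S * \int[lebesgue_measure]_(t in `[0, S]) (x t ^+ 2)).

(* Main.v *)
Require Import Defs.
From HB Require Import structures.
From mathcomp Require Import all_boot all_order all_algebra.
From mathcomp Require Import all_classical all_reals all_analysis.
From mathcomp Require Import measurable_realfun.
From mathcomp Require Import ring lra.

Import Order.TTheory GRing.Theory Num.Theory.
Import numFieldNormedType.Exports.

Set Implicit Arguments.
Unset Strict Implicit.
Unset Printing Implicit Defensive.
Local Open Scope classical_set_scope.
Local Open Scope ring_scope.

(* Only second and fourth moments matter.  For step functions [f], [g] the
   integrals [I f], [I g] against [W] are sums of independent centred normal
   variables, so that (Wick's formula)
     E (I f * I g) = <f, g>,
     E (I f ^+ 2 * I g ^+ 2) = <f, f> <g, g> + 2 <f, g> ^+ 2.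
   In the L^2 limit the first identity persists, and by Fatou's lemma the second
   one persists as an upper bound.  With s = 1 / (2 theta) this gives
   E (xi_t ^+ 2) = s and
   E (xi_t ^+ 2 * xi_u ^+ 2) <= s ^+ 2 + 2 s ^+ 2 exp (- 2 theta |t - u|),
   whence the variance of the time average of [xi ^+ 2] over [0, S] is at most
   8 s ^+ 3 / S.  This is summable along S = m ^+ 2 * h, so the averages converge
   a.s. along this sequence, and then along all S = n * h because the integral is
   monotone in S.  In the same way E (xi_(n h) ^+ 4) / n ^+ 2 is summable, hence
   xi_(n h) ^+ 2 / n tends to 0 a.s. and the estimator tends to theta.  Finally
   |rho_a - rho_b| <= |a - b| h for a, b >= 0. *)

(** * Moments of sums of independent normal variables *)

(** The obstacle is that [xi t] is known only as an L^2 limit, a mode of convergence that does not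
    carry fourth moments to the limit. Fatou's lemma loses an equality but in the harmless
    direction: the mean of [xi t ^+ 2] is exact, so an upper bound on the mixed moment bounds the
    covariance from above, and a variance estimate asks for no more. For step functions, Wick's
    formula rests on an algebraic fact: having fourth moment three times the squared variance is
    stable under sums of independent centred variables. Applied to all linear combinations of
    increments, it yields the mixed moments. The constant 8 arises from discretisation. Integrating
    the covariance bound over the square gives at most 4 s^3 / S; the sampled version meets a
    geometric series of ratio exp (- x), and 1 - exp (- x) >= x / 2 costs a factor 2 but is uniform
    in the mesh. Squares are a compromise: sparse enough for 1 / m^2 to be summable, dense enough
    for (m + 1)^2 / m^2 to tend to 1, which monotone interpolation requires. *)

Section independence.
Context {d : measure_display} {T : measurableType d} {R : realType}.
Variable P : probability T R.
Implicit Types X Y Z : T -> R.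

(** Rectangles are stable under intersection, generate the product sigma-algebra and include the
    whole space, so the uniqueness theorem for measures applies with the constant cover by [setT],
    of finite mass. *)
Lemma eq_measure_rect d1 d2 (T1 : measurableType d1) (T2 : measurableType d2)
    (m1 m2 : {measure set (T1 * T2) -> \bar R}) : (m1 setT < +oo)%E ->
  (forall A B, measurable A -> measurable B -> m1 (A `*` B) = m2 (A `*` B)) ->
  forall E, measurable E -> m1 E = m2 E.
Proof.
move=> m1fin m12 E mE.
pose C : set (set (T1 * T2)) :=
  [set C | exists A, measurable A /\ exists B, measurable B /\ C = A `*` B].
apply: (measure_unique C (fun=> setT)) => //.
- rewrite measurable_prod_measurableType //; congr (<<s _ >>).
  rewrite predeqE; split => [[A mA [B mB <-]]|[A [mA [B [mB ->]]]]].
    by exists A; split => //; exists B.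
  by exists A => //; exists B.
- move=> /= _ _ [X1 [mX1 [X2 [mX2 ->]]]] [Y1 [mY1 [Y2 [mY2 ->]]]].
  rewrite -setXI; exists (X1 `&` Y1); split; first exact: measurableI.
  by exists (X2 `&` Y2); split => //; exact: measurableI.
- by move=> _; exists setT; split => //; exists setT; split => //; rewrite setXTT.
- by rewrite bigcup_const.
- by move=> A [A1 [mA1 [A2 [mA2 ->]]]]; exact: m12.
Qed.

(** Only [k = 1] is used later, but the induction on [m] needs a block of [k] untouched variables:
    passing from [m] to [m.+1] moves [X m] out of that block into the sum, so the hypothesis is
    called with [k.+1]. *)
Lemma mutually_independent_partial_sum (X : nat -> T -> R) (c : nat -> R) :
  (forall i, measurable_fun setT (X i)) ->
  (forall n, mutually_independent P (fun i : 'I_n => X i)) ->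
  forall m k (A : set R) (B : nat -> set R), measurable A ->
  (forall i, measurable (B i)) ->
  P [set w | A (\sum_(i < m) c i * X i w) /\
             forall i, (i < k)%N -> B i (X (m + i)%N w)] =
  (P [set w | A (\sum_(i < m) c i * X i w)%R] *
    \prod_(i < k) P (X (m + i)%N @^-1` B i))%E.
Proof.
move=> mX iX.
have mS m : measurable_fun setT (fun w => \sum_(i < m) c i * X i w).
  by apply: measurable_sum => i; exact: measurable_funM.
have mpre (A : set R) (f : T -> R) : measurable_fun setT f -> measurable A ->
    measurable (f @^-1` A).
  by move=> mf mA; rewrite -[_ @^-1` _]setTI; exact: mf.
have mcyl m k B : (forall i, measurable (B i)) ->
    measurable [set w | forall i, (i < k)%N -> B i (X (m + i)%N w)].
  move=> mB.
  rewrite (_ : [set w | _] =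
      \bigcap_(i in [set i | (i < k)%N]) (X (m + i)%N @^-1` B i)) //.
  by apply: bigcap_measurableType => i _; exact: mpre.
elim=> [|m IH] k A B mA mB.
  under [X in P X]eq_set do rewrite big_ord0.
  under [X in (P X * _)%E]eq_set do rewrite big_ord0.
  have [A0|nA0] := pselect (A 0).
    rewrite (_ : [set _ | A 0] = setT); last by apply/seteqP; split.
    rewrite probability_setT mul1e -(iX k (fun i => B i))//.
    congr (P _); apply/seteqP; split=> w /=; first by move=> [_ h] i; exact: h.
    by move=> h; split=> // i ik; exact: (h (Ordinal ik)).
  rewrite (_ : [set w | A 0 /\ _] = set0); last by apply/seteqP; split=> // w [].
  rewrite (_ : [set _ | A 0] = set0); last by apply/seteqP; split.
  by rewrite measure0 mul0e.
pose C := [set w | forall i, (i < k)%N -> B i (X (m.+1 + i)%N w)].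
have mC : measurable C by exact: mcyl.
pose S := fun w => \sum_(i < m) c i * X i w.
pose V w := (S w, X m w).
have mV : measurable_fun setT V.
  by apply/measurable_fun_pairP; split; [exact: mS|exact: mX].
pose B' D i := if i is j.+1 then B j else D.
have rectE (D D' : set R) : measurable D -> measurable D' ->
    P ((S @^-1` D `&` X m @^-1` D') `&` C) =
    (P (S @^-1` D) * (P (X m @^-1` D') *
       \prod_(i < k) P (X (m.+1 + i)%N @^-1` B i)))%E.
  move=> mD mD'; have := IH k.+1 D (B' D') mD.
  rewrite big_ord_recl/= addn0.
  under eq_bigr do rewrite /bump/= add1n addnS -addSn.
  move=> <-; last by case.
    congr (P _); apply/seteqP; split=> w /=.
      move=> [[SD XD] Cw]; split=> // -[|i] ik /=; rewrite ?addn0//.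
      by rewrite addnS -addSn; exact: Cw.
    move=> [SD h]; split; first by split=> //; have := h 0%N; rewrite addn0; exact.
    by move=> i ik; have := h i.+1; rewrite addnS -addSn; exact.
pose p := (\prod_(i < k) P (X (m.+1 + i)%N @^-1` B i))%E.
have PC : P C = p.
  have := rectE _ _ (@measurableT _ R) (@measurableT _ R).
  by rewrite !preimage_setT !setTI probability_setT !mul1e.
have p0 : 0 <= fine p by rewrite -PC fine_ge0.
have pE : p = (fine p)%:E by rewrite -PC fineK// fin_num_measure.
(* [lawC] is the law of [(S, X m)] on the event [C], to be compared with [p] times the full law of
   the pair. They agree on rectangles by induction, hence also on the set where [z.1 + c m * z.2]
   lies in [A], which is not a rectangle. *)
pose lawC : {measure set (R * R) -> \bar R} := pushforward (mrestr P mC) V.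
pose law : {measure set (R * R) -> \bar R} := pushforward P V.
pose mu1 := lawC mV.
pose mu2 : {measure set (R * R) -> \bar R} :=
  mscale (NngNum p0) (law mV).
have mu12 E : measurable E -> mu1 E = mu2 E.
  apply: eq_measure_rect.
    rewrite /mu1/lawC/= /pushforward /mrestr preimage_setT setTI.
    by rewrite (le_lt_trans (probability_le1 _ mC))// ltry.
  move=> D D' mD mD'.
  rewrite /mu1 /mu2 /lawC /law/= /mscale /pushforward /mrestr/= -pE.
  have VE : V @^-1` (D `*` D') = S @^-1` D `&` X m @^-1` D' by [].
  rewrite VE rectE// -/p muleA [RHS]muleC; congr (_ * _)%E.
  have := IH 1%N D (fun=> D') mD (fun=> mD').
  rewrite big_ord1 addn0 => <-; congr (P _); apply/seteqP; split=> w /=.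
    by move=> [SD h]; split=> //; have := h 0%N; rewrite addn0; exact.
  by move=> [SD h]; split=> // -[|//] _; rewrite addn0.
have mE : measurable [set z : R * R | A (z.1 + c m * z.2)].
  rewrite -[X in measurable X]setTI.
  apply: (_ : measurable_fun setT (fun z : R * R => z.1 + c m * z.2)) => //.
  by apply: measurable_funD => //; apply: measurable_funM.
have := mu12 _ mE.
rewrite /mu1 /mu2 /lawC /law/= /mscale /pushforward /mrestr/= -pE muleC => pQ.
transitivity (P ([set w | A (S w + c m * X m w)] `&` C)).
  by congr (P _); apply/seteqP; split=> w /=; rewrite big_ord_recr.
rewrite [LHS]pQ -/p; congr (P _ * _)%E.
by apply/seteqP; split=> w /=; rewrite big_ord_recr.
Qed.
End independence.

Section expectation_indep.
Context {d : measure_display} {T : measurableType d} {R : realType}.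
Variable P : probability T R.

(** Independence identifies the law of [(X, Y)] with the product of the two laws. Tonelli's theorem
    then gives integrability of the product, and Fubini's theorem splits its integral. *)
Lemma integral_indep_mul (X Y : {mfun T >-> R}) (f g : R -> R) :
  (forall A B, measurable A -> measurable B ->
    P (X @^-1` A `&` Y @^-1` B) = (P (X @^-1` A) * P (Y @^-1` B))%E) ->
  measurable_fun setT f -> measurable_fun setT g ->
  P.-integrable setT (fun w => (f (X w))%:E) ->
  P.-integrable setT (fun w => (g (Y w))%:E) ->
  P.-integrable setT (fun w => (f (X w) * g (Y w))%:E) /\
  (\int[P]_w (f (X w) * g (Y w)) = \int[P]_w f (X w) * \int[P]_w g (Y w)).
Proof.
move=> XY mf mg If Ig.
pose V w := (X w, Y w).
have mV : measurable_fun setT V by apply/measurable_fun_pairP; split.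
pose law : {measure set (R * R) -> \bar R} := pushforward P V.
pose m1 := distribution P X; pose m2 := distribution P Y.
have lawE E : measurable E -> (m1 \x m2)%E E = law mV E.
  by apply: product_measure_unique => A B mA mB; exact: XY.
pose F := fun z : R * R => (f z.1 * g z.2)%:E.
have mF : measurable_fun setT F.
  apply/measurable_EFinP/measurable_funM.
    exact: measurableT_comp.
  exact: measurableT_comp.
have mEf : measurable_fun setT (EFin \o f) by exact/measurable_EFinP.
have mEg : measurable_fun setT (EFin \o g) by exact/measurable_EFinP.
have I1 : m1.-integrable setT (EFin \o f).
  apply/integrableP; split => //.
  rewrite /m1 ge0_integral_distribution//; last exact: measurableT_comp.
  by have /integrableP[] := If.
have I2 : m2.-integrable setT (EFin \o g).
  apply/integrableP; split => //.
  rewrite /m2 ge0_integral_distribution//; last exact: measurableT_comp.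
  by have /integrableP[] := Ig.
have IF : (m1 \x m2)%E.-integrable setT F.
  have mag : measurable_fun setT (fun y => (`|g y|)%:E).
    by apply/measurable_EFinP; exact: measurableT_comp.
  have maf : measurable_fun setT (fun y => (`|f y|)%:E).
    by apply/measurable_EFinP; exact: measurableT_comp.
  apply/integrable12ltyP => //.
  under eq_integral => x _.
    under eq_integral => y _ do rewrite /F/= normrM EFinM.
    rewrite ge0_integralZl//=.
    over.
  rewrite ge0_integralZr//=; last exact: integral_ge0.
  have /integrableP[_ I1oo] := I1; have /integrableP[_ I2oo] := I2.
  by rewrite lte_mul_pinfty// ?integral_ge0// ge0_fin_numE// integral_ge0.
have lawI h : (forall z : R * R, 0 <= h z)%E -> measurable_fun setT h ->
    (\int[m1 \x m2]_z h z = \int[P]_w h (V w))%E.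
  move=> h0 mh; rewrite (eq_measure_integral (law mV)); last first.
    by move=> A mA _; exact: lawE.
  by rewrite ge0_integral_pushforward.
have IFV : P.-integrable setT (F \o V).
  apply/integrableP; split; first exact: measurableT_comp.
  have /integrableP[_] := IF.
  by rewrite lawI//; exact: measurableT_comp.
split; first exact: IFV.
rewrite /Rintegral.
have -> : (\int[P]_w (f (X w) * g (Y w))%:E = \int[m1 \x m2]_z F z)%E.
  rewrite (eq_measure_integral (law mV)); last by move=> A mA _; exact: lawE.
  by rewrite integral_pushforward.
rewrite -integral12_prod_meas1// /fubini_F.
under [X in fine X = _]eq_integral => x _.
  under eq_integral => y _ do rewrite /F/= EFinM.
  rewrite integralZl//=.
  over.
have -> : (\int[P]_w (f (X w))%:E = \int[m1]_x (f x)%:E)%E.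
  by rewrite /m1 integral_distribution.
have -> : (\int[P]_w (g (Y w))%:E = \int[m2]_x (g x)%:E)%E.
  by rewrite /m2 integral_distribution.
rewrite -fineM; [|exact: integrable_fin_num..].
rewrite -(fineK (integrable_fin_num measurableT I2))/=.
by rewrite integralZr.
Qed.
End expectation_indep.

(** * Densities and Gaussian integrals *)

Section density.
Context {d : measure_display} {T : measurableType d} {R : realType}.
Variables (mu nu : {measure set T -> \bar R}) (p : T -> R).
Local Open Scope ereal_scope.
Import HBNNSimple.

(** Linearity settles simple functions, and monotone convergence on both sides settles the rest. It
    turns expectations of normal variables into Lebesgue integrals. *)
Lemma ge0_integral_density (f : T -> \bar R) :
  measurable_fun setT p -> (forall x, (0 <= p x)%R) ->
  (forall A, measurable A -> nu A = \int[mu]_(x in A) (p x)%:E) ->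
  measurable_fun setT f -> (forall x, 0 <= f x) ->
  \int[nu]_x f x = \int[mu]_x (f x * (p x)%:E).
Proof.
move=> mp p0 nuE mf f0.
have mEp : measurable_fun setT (EFin \o p) by exact/measurable_EFinP.
pose f_ := nnsfun_approx measurableT mf.
transitivity (limn (fun n => \int[nu]_x (f_ n x)%:E)).
  rewrite -monotone_convergence//.
  - by apply: eq_integral => x _; apply/esym/cvg_lim => //; exact: cvg_nnsfun_approx.
  - by move=> n; exact/measurable_EFinP.
  - by move=> *; rewrite lee_fin.
  - by move=> x _ m n mn; rewrite lee_fin; exact/lefP/nd_nnsfun_approx.
transitivity (limn (fun n => \int[mu]_x ((f_ n x)%:E * (p x)%:E))); last first.
  rewrite -monotone_convergence//.
  - apply: eq_integral => x _; apply/cvg_lim => //.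
    by apply: cvgeZr => //; exact: cvg_nnsfun_approx.
  - by move=> n; apply: emeasurable_funM => //; exact/measurable_EFinP.
  - by move=> *; rewrite mule_ge0// lee_fin.
  - move=> x _ m n mn; rewrite lee_wpmul2r ?lee_fin//.
    exact/lefP/nd_nnsfun_approx.
congr (limn _); apply/funext => n.
rewrite integralT_nnsfun sintegralE.
have mE r : measurable (f_ n @^-1` [set r]).
  by rewrite -[X in measurable X]setTI; exact: measurable_funP.
transitivity (\int[mu]_x
    \sum_(r \in range (f_ n)) ((r * \1_(f_ n @^-1` [set r]) x)%:E * (p x)%:E)).
  rewrite ge0_integral_fsum//; last 2 first.
  - move=> r; apply: emeasurable_funM => //; apply/measurable_EFinP.
    by apply: measurable_funM => //; exact: measurable_indic.
  - by move=> r x _; rewrite mule_ge0 ?lee_fin// -lee_fin EFinM nnfun_muleindic_ge0.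
  apply: eq_fsbigr => r /set_mem[x _ <-]; rewrite nuE// integral_mkcond.
  rewrite -ge0_integralZl//; last 3 first.
  - by apply/(measurable_restrictT _ _).1 => //; exact: measurable_funTS.
  - by move=> y _; rewrite patchE; case: ifP => // _; rewrite lee_fin.
  - by rewrite lee_fin.
  apply: eq_integral => y _; rewrite patchE indicE EFinM.
  by case: (y \in _); rewrite ?mule1// !mule0 mul0e.
apply: eq_integral => x _.
under eq_fsbigr do rewrite -EFinM.
by rewrite fsumEFin// -mulr_fsuml -fimfunE EFinM.
Qed.
End density.

Section normal_moments.
Context {R : realType}.
Notation mu := (@lebesgue_measure R).

(** Read off from the total mass 1 of the centred normal density whose standard deviation [s]
    satisfies [2 s^2 = 1 / c], so that its exponent is [- c x^2]. *)
Lemma integral_expNsqr (c : R) : 0 < c ->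
  (\int[mu]_x (expR (- (c * x ^+ 2)))%:E = (Num.sqrt pi / Num.sqrt c)%:E)%E.
Proof.
move=> c0; pose s := (Num.sqrt (c *+ 2))^-1.
have s0 : s != 0 by rewrite invr_neq0// gt_eqF// sqrtr_gt0 pmulrn_lgt0.
have := integral_normal_pdf 0 s; rewrite normal_pdfE//.
have s2 : s ^+ 2 = (c *+ 2)^-1 by rewrite exprVn sqr_sqrtr// mulrn_wge0// ltW.
have pk : normal_peak s = (Num.sqrt pi / Num.sqrt c)^-1.
  rewrite /normal_peak s2; congr (_^-1); rewrite -sqrtrV ?ltW// -sqrtrM ?pi_ge0//.
  by congr (Num.sqrt _); field; rewrite gt_eqF.
under eq_integral do rewrite EFinM.
rewrite ge0_integralZl//; last 3 first.
- by apply/measurable_EFinP; exact: measurable_normal_fun.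
- by move=> x _; rewrite lee_fin expR_ge0.
- by rewrite lee_fin normal_peak_ge0.
have -> : (\int[mu]_x (normal_fun 0 s x)%:E =
    \int[mu]_x (expR (- (c * x ^+ 2)))%:E)%E.
  apply: eq_integral => x _; rewrite /normal_fun s2 subr0; congr (expR _)%:E.
  by field; rewrite gt_eqF.
have sp : 0 < Num.sqrt pi / Num.sqrt c by rewrite divr_gt0// sqrtr_gt0// pi_gt0.
move=> /(congr1 (fun z => (Num.sqrt pi / Num.sqrt c)%:E * z)%E).
by rewrite muleA -EFinM pk divff ?gt_eqF// mul1e mule1.
Qed.

(* Differentiation of [c |-> \int f x * exp (- c x^2)] under the integral sign,
   obtained by squeezing with [1 + u <= expR u]. *)
Lemma integral_sqr_expNsqr (f : R -> R) (J G : R -> R) (c : R) : 0 < c ->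
  measurable_fun setT f -> (forall x, 0 <= f x) ->
  (forall a, 0 < a -> (\int[mu]_x (f x * expR (- (a * x ^+ 2)))%:E = (J a)%:E)%E) ->
  (forall e, `|e| < c -> J c - J (c + e) = e * G e) ->
  {for 0, continuous G} ->
  (\int[mu]_x (f x * x ^+ 2 * expR (- (c * x ^+ 2)))%:E = (G 0)%:E)%E.
Proof.
move=> c0 mf f0 JE JG cG.
set A := (\int[mu]_x _)%E.
have mg a : measurable_fun setT (fun x : R => expR (- (a * x ^+ 2))).
  apply: measurableT_comp => //; apply: measurableT_comp => //.
  by apply: measurable_funM => //; exact: measurable_funX.
have mfg a : measurable_fun setT (fun x : R => f x * expR (- (a * x ^+ 2))).
  exact: measurable_funM.
have mfxg : measurable_fun setT
    (fun x : R => f x * x ^+ 2 * expR (- (c * x ^+ 2))).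
  by apply: measurable_funM => //; apply: measurable_funM => //; exact: measurable_funX.
have mA : measurable_fun setT
    (fun x : R => (f x * x ^+ 2 * expR (- (c * x ^+ 2)))%:E).
  exact/measurable_EFinP.
have fxg0 x : 0 <= f x * x ^+ 2 * expR (- (c * x ^+ 2)).
  by rewrite mulr_ge0 ?expR_ge0// mulr_ge0 ?sqr_ge0.
have fg0 a x : 0 <= f x * expR (- (a * x ^+ 2)) by rewrite mulr_ge0// expR_ge0.
have eAE e a : 0 < e -> 0 < a -> (e%:E * A + (J a)%:E = \int[mu]_x
    (e * (f x * x ^+ 2 * expR (- (c * x ^+ 2))) +
      f x * expR (- (a * x ^+ 2)))%:E)%E.
  move=> e0 a0; rewrite -(JE _ a0) -ge0_integralZl//; last 2 first.
  - by move=> x _; rewrite lee_fin.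
  - by rewrite lee_fin ltW.
  rewrite -ge0_integralD//.
  - by move=> x _; rewrite mule_ge0// lee_fin// ltW.
  - exact: measurable_funeM.
  - by move=> x _; rewrite lee_fin.
  - by apply/measurable_EFinP; exact: mfg.
have mI e a : measurable_fun setT (fun x : R =>
    (e * (f x * x ^+ 2 * expR (- (c * x ^+ 2))) + f x * expR (- (a * x ^+ 2)))%:E).
  by apply/measurable_EFinP/measurable_funD => //; exact: measurable_funM.
(* [G] is the difference quotient of [- J] at [c], so that [G 0] stands for minus the derivative of
   [J]. The quotient on the left of [c] bounds the integral from above, the one on the right from
   below. *)
have ub e : 0 < e -> e < c -> (A <= (G (- e))%:E)%E.
  move=> e0 ec.
  have ne : `|- e| < c by rewrite normrN gtr0_norm.
  have ce : 0 < c + - e by rewrite subr_gt0.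
  have : (e%:E * A + (J c)%:E <= (J (c - e))%:E)%E.
    rewrite eAE// -(JE _ ce); apply: ge0_le_integral => //.
    - by move=> x _; rewrite lee_fin addr_ge0// mulr_ge0// ltW.
    - exact: mI.
    - by apply/measurable_EFinP; exact: mfg.
    - move=> x _; rewrite lee_fin.
      have -> : - ((c + - e) * x ^+ 2) = e * x ^+ 2 + - (c * x ^+ 2) by ring.
      rewrite expRD; set g := expR (- _); set u := e * x ^+ 2.
      have -> : e * (f x * x ^+ 2 * g) + f x * g = f x * ((1 + u) * g).
        by rewrite /u; ring.
      by rewrite ler_wpM2l// ler_wpM2r ?expR_ge0// expR_ge1Dx.
  rewrite -leeBrDr// -EFinB -lee_pdivlMl// -EFinM.
  by rewrite -opprB JG// mulNr opprK mulKf ?gt_eqF.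
have lb e : 0 < e -> e < c -> ((G e)%:E <= A)%E.
  move=> e0 ec.
  have ne : `|e| < c by rewrite gtr0_norm.
  have ce : 0 < c + e by rewrite addr_gt0.
  have : ((J c)%:E <= e%:E * A + (J (c + e))%:E)%E.
    rewrite eAE// -(JE _ c0); apply: ge0_le_integral => //.
    - by move=> x _; rewrite lee_fin.
    - by apply/measurable_EFinP; exact: mfg.
    - exact: mI.
    - move=> x _; rewrite lee_fin.
      have -> : - ((c + e) * x ^+ 2) = - (e * x ^+ 2) + - (c * x ^+ 2) by ring.
      rewrite expRD; set g := expR (- (c * _)); set u := e * x ^+ 2.
      have -> : e * (f x * x ^+ 2 * g) + f x * (expR (- u) * g) =
          f x * ((u + expR (- u)) * g) by rewrite /u; ring.
      rewrite ler_wpM2l// -[leLHS]mul1r ler_wpM2r ?expR_ge0//.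
      by rewrite -lerBlDl expR_ge1Dx.
  rewrite -leeBlDr// -EFinB -lee_pdivrMl// -EFinM.
  by rewrite JG// mulKf ?gt_eqF.
have Gnear d : 0 < d -> exists2 e, 0 < e < c & G (- e) <= G 0 + d /\ G 0 - d <= G e.
  move=> d0; have /cvgrPdist_le/(_ _ d0)/nbhs_ballP[r /= r0 rG] := cG.
  pose e := Num.min r c / 2.
  have e0 : 0 < e by rewrite divr_gt0// lt_min r0.
  have em : e < Num.min r c by rewrite /e ltr_pdivrMr// ltr_pMr ?ltr1n// lt_min r0.
  move: em; rewrite lt_min => /andP[er ec].
  exists e; first by rewrite e0.
  have := rG e; rewrite /ball/= sub0r normrN gtr0_norm// => /(_ er).
  have := rG (- e); rewrite /ball/= sub0r normrN normrN gtr0_norm// => /(_ er).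
  rewrite !ler_norml; lra.
apply/eqP; rewrite eq_le; apply/andP; split.
  apply/lee_addgt0Pr => d d0; have [e /andP[e0 ec] [H _]] := Gnear d d0.
  by rewrite (le_trans (ub _ e0 ec))// -EFinD lee_fin.
apply/lee_addgt0Pr => d d0; have [e /andP[e0 ec] [_ H]] := Gnear d d0.
by rewrite -leeBlDr// (le_trans _ (lb _ e0 ec))// -EFinB lee_fin.
Qed.

(** With q = sqrt c and p = sqrt (c + e) one has e = p^2 - q^2. The factor p - q therefore cancels
    in the difference quotient of sqrt pi / sqrt a, and what remains is continuous at e = 0. *)
Lemma integral_sqr_gauss (c : R) : 0 < c ->
  (\int[mu]_x (x ^+ 2 * expR (- (c * x ^+ 2)))%:E =
    (Num.sqrt pi / (2 * Num.sqrt c ^+ 3))%:E)%E.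
Proof.
move=> c0.
have := @integral_sqr_expNsqr (cst 1) (fun a => Num.sqrt pi / Num.sqrt a)
  (fun e => Num.sqrt pi /
     ((Num.sqrt c + Num.sqrt (c + e)) * Num.sqrt c * Num.sqrt (c + e))) c c0.
set q := Num.sqrt c.
have q0 : 0 < q by rewrite sqrtr_gt0.
have cS : {for 0, continuous (fun e => Num.sqrt (c + e))}.
  apply: continuous_comp; first by apply: cvgD; [exact: cvg_cst|exact: cvg_id].
  exact: sqrt_continuous.
rewrite addr0 => H.
have -> : Num.sqrt pi / (2 * q ^+ 3) = Num.sqrt pi / ((q + q) * q * q).
  by field; rewrite !gt_eqF ?addr_gt0.
rewrite -H//.
- by apply: eq_integral => x _; rewrite mul1r.
- by move=> a a0; under eq_integral do rewrite mul1r; exact: integral_expNsqr.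
- move=> e ec; have ce : 0 < c + e by move: ec; rewrite ltr_norml; lra.
  set p := Num.sqrt (c + e).
  have p0 : 0 < p by rewrite sqrtr_gt0.
  have -> : e = p ^+ 2 - q ^+ 2 by rewrite !sqr_sqrtr ?ltW//; ring.
  by field; rewrite !gt_eqF// addr_gt0.
- apply: cvgM; first exact: cvg_cst.
  apply: cvgV; first by rewrite addr0 gt_eqF// !mulr_gt0// addr_gt0.
  apply: cvgM; last exact: cS.
  apply: cvgM; last exact: cvg_cst.
  by apply: cvgD; [exact: cvg_cst|exact: cS].
Qed.

(** A second differentiation, now with weight x^2 and the previous integral as [J]. Factoring p^3 -
    q^3 leaves q^2 + q p + p^2 in the quotient. *)
Lemma integral_exp4_gauss (c : R) : 0 < c ->
  (\int[mu]_x (x ^+ 4 * expR (- (c * x ^+ 2)))%:E =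
    (3 * Num.sqrt pi / (4 * Num.sqrt c ^+ 5))%:E)%E.
Proof.
move=> c0.
have := @integral_sqr_expNsqr (fun x => x ^+ 2)
  (fun a => Num.sqrt pi / (2 * Num.sqrt a ^+ 3))
  (fun e => let q := Num.sqrt c in let p := Num.sqrt (c + e) in
     Num.sqrt pi / 2 * (q ^+ 2 + q * p + p ^+ 2) /
     ((q + p) * q ^+ 3 * p ^+ 3)) c c0.
rewrite /=; set q := Num.sqrt c.
have q0 : 0 < q by rewrite sqrtr_gt0.
have cS : {for 0, continuous (fun e => Num.sqrt (c + e))}.
  apply: continuous_comp; first by apply: cvgD; [exact: cvg_cst|exact: cvg_id].
  exact: sqrt_continuous.
rewrite addr0 => H.
have -> : 3 * Num.sqrt pi / (4 * q ^+ 5) = Num.sqrt pi / 2 *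
  (q ^+ 2 + q * q + q ^+ 2) / ((q + q) * q ^+ 3 * q ^+ 3).
  by field; rewrite !gt_eqF ?addr_gt0.
rewrite -H//.
- by apply: eq_integral => x _; rewrite -exprD.
- by move=> x; rewrite sqr_ge0.
- by move=> a a0; exact: integral_sqr_gauss.
- move=> e ec; have ce : 0 < c + e by move: ec; rewrite ltr_norml; lra.
  set p := Num.sqrt (c + e).
  have p0 : 0 < p by rewrite sqrtr_gt0.
  have -> : e = p ^+ 2 - q ^+ 2 by rewrite !sqr_sqrtr ?ltW//; ring.
  by field; rewrite !gt_eqF// addr_gt0.
- apply: cvgM.
    apply: cvgM; first exact: cvg_cst.
    apply: cvgD; last by apply: cvgM; exact: cS.
    by apply: cvgD; [exact: cvg_cst|apply: cvgM; [exact: cvg_cst|exact: cS]].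
  apply: cvgV; first by rewrite addr0 gt_eqF// !mulr_gt0// ?exprn_gt0// addr_gt0.
  apply: cvgM; last by do 2 (apply: cvgM; [exact: cS|]); exact: cS.
  apply: cvgM; last exact: cvg_cst.
  by apply: cvgD; [exact: cvg_cst|exact: cS].
Qed.
End normal_moments.

(** The reflection pulls ]a, b] back to [c - b, c - a[, of equal length, and Lebesgue measure is
    determined by the lengths of intervals. It serves with [c = 0] for the symmetry of the normal
    law and with [c = s] for the exponential kernel. *)
Lemma ge0_lebesgue_integral_reflect {R : realType} (c : R)
    (f : measurableTypeR R -> \bar R) :
  measurable_fun setT f -> (forall x, 0 <= f x)%E ->
  (\int[@lebesgue_measure R]_x f (c - x)%R = \int[@lebesgue_measure R]_x f x)%E.
Proof.
move=> mf f0; pose r x := (c - x : measurableTypeR R).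
have mr : measurable_fun setT (r : measurableTypeR R -> _).
  apply: (@continuous_measurable_fun R) => x.
  by apply: cvgB; [exact: cvg_cst|exact: cvg_id].
transitivity (\int[pushforward (@lebesgue_measure R) r]_x f x)%E.
  by rewrite ge0_integral_pushforward.
apply: eq_measure_integral => A mA _.
apply/esym/lebesgue_measure_unique => //= _ [[a b]] _ <-.
rewrite /pushforward (_ : r @^-1` _ = `[c - b, c - a[%classic).
  rewrite !lebesgue_measure_itv/= !lte_fin ltrD2l ltrN2.
  by case: ifP => // _; rewrite -!EFinB; congr EFin; ring.
apply/seteqP; split=> x /=; rewrite !in_itv/= /r;
  by move=> /andP[h1 h2]; apply/andP; split; lra.
Qed.

Section normal_variable.
Context {d : measure_display} {T : measurableType d} {R : realType}.
Variable P : probability T R.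
Notation mu := (@lebesgue_measure R).

Lemma ge0_integral_normal_variable (N : {mfun T >-> R}) (v : R) (f : R -> \bar R) :
  (forall A, measurable A ->
    P (N @^-1` A) = normal_prob 0 (Num.sqrt v) A) ->
  measurable_fun setT f -> (forall x, 0 <= f x)%E ->
  (\int[P]_w f (N w) = \int[mu]_x (f x * (normal_pdf 0 (Num.sqrt v) x)%:E))%E.
Proof.
move=> PN mf f0.
have mN : measurable_fun setT (N : T -> measurableTypeR R) by exact: (measurable_funP N).
pose nu : {measure set (measurableTypeR R) -> \bar R} :=
  pushforward P (N : T -> measurableTypeR R).
transitivity (\int[nu mN]_x f x)%E.
  by rewrite /nu ge0_integral_pushforward.
apply: ge0_integral_density => //.
- exact: measurable_normal_pdf.
- by move=> x; exact: normal_pdf_ge0.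
Qed.

Lemma normal_pdf_gauss (v x : R) : 0 < v ->
  normal_pdf 0 (Num.sqrt v) x =
  Num.sqrt (v *+ 2)^-1 / Num.sqrt pi * expR (- ((v *+ 2)^-1 * x ^+ 2)).
Proof.
move=> v0; rewrite normal_pdfE ?gt_eqF ?sqrtr_gt0//.
rewrite /normal_peak /normal_fun sqr_sqrtr ?ltW// subr0; congr (_ * expR _).
  rewrite -sqrtrV ?mulrn_wge0 ?mulr_ge0 ?pi_ge0 ?ltW//.
  rewrite -[(Num.sqrt pi)^-1]sqrtrV ?pi_ge0// -sqrtrM ?invr_ge0 ?mulrn_wge0 ?ltW//.
  by rewrite -mulrnAl invfM.
by field; rewrite gt_eqF.
Qed.

Lemma normal_variable_moments (N : {mfun T >-> R}) (v : R) : 0 < v ->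
  (forall A, measurable A ->
    P (N @^-1` A) = normal_prob 0 (Num.sqrt v) A) ->
  [/\ \int[P]_w N w = 0,
     (\int[P]_w (N w ^+ 2)%:E = v%:E)%E &
     (\int[P]_w (N w ^+ 4)%:E = (3 * v ^+ 2)%:E)%E].
Proof.
move=> v0 PN; pose c := (v *+ 2)^-1; pose q := Num.sqrt c.
have c0 : 0 < c by rewrite invr_gt0 mulrn_wgt0.
have q0 : 0 < q by rewrite sqrtr_gt0.
have s0 : 0 < Num.sqrt pi :> R by rewrite sqrtr_gt0 pi_gt0.
have vE : v = (2 * q ^+ 2)^-1.
  by rewrite sqr_sqrtr ?ltW// /c; field; rewrite gt_eqF.
have mg : measurable_fun setT (fun x : R => expR (- (c * x ^+ 2))).
  apply: measurableT_comp => //; apply: measurableT_comp => //.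
  by apply: measurable_funM => //; exact: measurable_funX.
have evenE k : (\int[P]_w (N w ^+ k.*2)%:E = (q / Num.sqrt pi)%:E *
    \int[mu]_x (x ^+ k.*2 * expR (- (c * x ^+ 2)))%:E)%E.
  rewrite (ge0_integral_normal_variable (f := fun x => (x ^+ k.*2)%:E) PN)//; last 2 first.
  - by apply/measurable_EFinP; exact: measurable_funX.
  - by move=> x; rewrite lee_fin exprn_even_ge0// odd_double.
  rewrite -ge0_integralZl//.
  - by apply: eq_integral => x _; rewrite normal_pdf_gauss// -!EFinM mulrCA.
  - apply/measurable_EFinP; apply: measurable_funM => //; exact: measurable_funX.
  - by move=> x _; rewrite lee_fin mulr_ge0 ?expR_ge0// exprn_even_ge0// odd_double.
  - by rewrite lee_fin divr_ge0 ?ltW.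
split; last 2 first.
- rewrite (evenE 1%N) integral_sqr_gauss// -EFinM; congr EFin; rewrite vE -/q.
  by field; rewrite !gt_eqF.
- rewrite (evenE 2%N) integral_exp4_gauss// -EFinM; congr EFin; rewrite vE -/q.
  by field; rewrite !gt_eqF.
have mEFin : measurable_fun setT (EFin : R -> \bar R) by exact/measurable_EFinP.
have mEFinN : measurable_fun setT (fun x : R => (- x)%:E).
  by apply/measurable_EFinP.
(* The mean vanishes by symmetry: the positive and negative parts of [N] have the same integral [I].
   The final case analysis also covers infinite [I], where [fine] of the difference is 0. *)
pose I := (\int[mu]_x (maxe x%:E 0 * (normal_pdf 0 (Num.sqrt v) x)%:E))%E.
have pI : (\int[P]_w ((fun w => (N w)%:E)^\+ w) = I)%E.
  transitivity (\int[P]_w maxe (N w)%:E 0)%E.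
    by apply: eq_integral => w _; rewrite funeposE.
  rewrite (ge0_integral_normal_variable (f := fun x => maxe x%:E 0) PN)//.
    by apply: measurable_maxe.
  by move=> x; rewrite le_max lexx orbT.
have nI : (\int[P]_w ((fun w => (N w)%:E)^\- w) = I)%E.
  transitivity (\int[mu]_x (maxe (- x)%:E 0 * (normal_pdf 0 (Num.sqrt v) x)%:E))%E.
    transitivity (\int[P]_w maxe (- N w)%:E 0)%E.
      by apply: eq_integral => w _; rewrite funenegE.
    rewrite (ge0_integral_normal_variable (f := fun x => maxe (- x)%:E 0) PN)//.
      by apply: measurable_maxe.
    by move=> x; rewrite le_max lexx orbT.
  rewrite /I.
  transitivity (\int[mu]_x
      ((fun x => maxe x%:E 0 * (normal_pdf 0 (Num.sqrt v) x)%:E) (0 - x)%R))%E.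
    by apply: eq_integral => x _; rewrite /= sub0r !normal_pdf_gauss// sqrrN.
  apply: (ge0_lebesgue_integral_reflect 0
    (f := fun x => maxe x%:E 0 * (normal_pdf 0 (Num.sqrt v) x)%:E)%E).
    apply: emeasurable_funM; first exact: measurable_maxe.
    by apply/measurable_EFinP; exact: measurable_normal_pdf.
  by move=> x; rewrite mule_ge0 ?lee_fin ?normal_pdf_ge0// le_max lexx orbT.
rewrite /Rintegral integralE pI nI.
by case: I {pI nI} => [r| |]//=; rewrite subrr.
Qed.
End normal_variable.

(** * Second and fourth moments of sums *)

Section fourth_moments.
Context {d : measure_display} {T : measurableType d} {R : realType}.

Lemma eqfun_integrable (mu : {measure set T -> \bar R}) (f g : T -> \bar R) :
  mu.-integrable setT f -> f =1 g -> mu.-integrable setT g.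
Proof. by move=> If fg; exact: (eq_integrable _ f). Qed.

Lemma Rintegral_lincomb (mu : {measure set T -> \bar R}) n (k : nat -> R)
    (F : nat -> T -> R) :
  (forall i, (i < n)%N -> mu.-integrable setT (EFin \o F i)) ->
  mu.-integrable setT (fun w => (\sum_(i < n) k i * F i w)%:E) /\
  \int[mu]_w (\sum_(i < n) k i * F i w) = \sum_(i < n) k i * \int[mu]_w F i w.
Proof.
elim: n => [|n IH] iF.
  split.
    by apply: eqfun_integrable (integrable0 mu setT) _ => w; rewrite big_ord0.
  rewrite big_ord0; under eq_Rintegral do rewrite big_ord0.
  by rewrite Rintegral_cst// mul0r.
have [IHi IHe] := IH (fun i ni => iF i (ltnW ni)).
have ikF : mu.-integrable setT (EFin \o (fun w => k n * F n w)).
  exact: eqfun_integrable (integrableZl measurableT (k n) (iF n _)) _.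
split.
  apply: eqfun_integrable (integrableD measurableT IHi ikF) _ => w.
  by rewrite big_ord_recr.
under eq_Rintegral do rewrite big_ord_recr/=.
rewrite RintegralD// IHe big_ord_recr/=; congr (_ + _).
by rewrite RintegralZl//; exact: iF.
Qed.

Variable P : probability T R.

(** Domination by [1 + X w ^+ n.*2]: the first term handles [|X w| <= 1], the second the opposite
    case. The even exponent makes the dominating power nonnegative. *)
Lemma integrable_expr_le (X : T -> R) (n k : nat) : measurable_fun setT X ->
  P.-integrable setT (fun w => (X w ^+ n.*2)%:E) -> (k <= n.*2)%N ->
  P.-integrable setT (fun w => (X w ^+ k)%:E).
Proof.
move=> mX iX kn.
have i1 : P.-integrable setT (fun w => (1 + X w ^+ n.*2)%:E).
  exact: (integrableD measurableT (finite_measure_integrable_cst P 1 measurableT) iX).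
apply: (le_integrable _ _ _ i1) => //.
  by apply/measurable_EFinP; exact: measurable_funX.
move=> w _; rewrite lee_fin normrX.
have e0 : 0 <= X w ^+ n.*2 by rewrite exprn_even_ge0// odd_double.
rewrite [leRHS]ger0_norm ?addr_ge0//.
rewrite -[X w ^+ _]ger0_norm// normrX.
have [x1|x1] := leP `|X w| 1.
  by rewrite ler_wpDr ?exprn_ge0// exprn_ile1.
by rewrite ler_wpDl// ler_weXn2l// ltW.
Qed.

(** Induction by the binomial formula for S = S' + c X. As S' and X are centred and independent,
    every term with an odd exponent vanishes, and the fourth moment is 3 Q'^2 + 6 c^2 v Q' + 3 c^4
    v^2 = 3 (Q' + c^2 v)^2. *)
Lemma gaussian_sum_moments (X : nat -> {mfun T >-> R}) (v c : nat -> R) :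
  (forall n, mutually_independent P (fun i : 'I_n => X i : T -> R)) ->
  (forall i, \int[P]_w X i w = 0) ->
  (forall i, \int[P]_w (X i w ^+ 2) = v i) ->
  (forall i, P.-integrable setT (fun w => (X i w ^+ 4)%:E)) ->
  (forall i, \int[P]_w (X i w ^+ 4) = 3 * v i ^+ 2) ->
  forall m, let S := fun w => \sum_(i < m) c i * X i w in
    let Q := \sum_(i < m) c i ^+ 2 * v i in
  [/\ P.-integrable setT (fun w => (S w ^+ 4)%:E), \int[P]_w S w = 0,
      \int[P]_w (S w ^+ 2) = Q & \int[P]_w (S w ^+ 4) = 3 * Q ^+ 2].
Proof.
move=> iX X1 X2 IX4 X4; elim=> [|m IH] S Q.
  have S0 : S = cst 0 by apply/funext => w; rewrite /S big_ord0.
  rewrite S0 /Q big_ord0 /=; split.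
  - by apply: eqfun_integrable (integrable0 P setT) _ => w; rewrite /= expr0n.
  - by rewrite Rintegral_cst// mul0r.
  - by under eq_Rintegral do rewrite expr0n/=; rewrite Rintegral_cst// mul0r.
  - by under eq_Rintegral do rewrite expr0n/=; rewrite Rintegral_cst// mul0r expr0n mulr0.
move: IH; set S' := (fun w => \sum_(i < m) c i * X i w).
set Q' := (\sum_(i < m) c i ^+ 2 * v i) => -[IS1 S1 S2 S4].
have mS' : measurable_fun setT S'.
  by apply: measurable_sum => i; exact: measurable_funM.
pose S'm : {mfun T >-> R} := HB.pack S' (isMeasurableFun.Build _ _ _ _ _ mS').
have indep A B : measurable A -> measurable B ->
    P (S'm @^-1` A `&` X m @^-1` B) = (P (S'm @^-1` A) * P (X m @^-1` B))%E.
  move=> mA mB.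
  have := @mutually_independent_partial_sum _ _ _ P (fun i => X i : T -> R) c
    (fun i => measurable_funP (X i)) iX m 1%N A (fun=> B) mA (fun=> mB).
  rewrite big_ord1 addn0 => <-; congr (P _); apply/seteqP; split=> w /=.
    by move=> [SA XB]; split=> // -[|//] _; rewrite addn0.
  by move=> [SA h]; split=> //; have := h 0%N; rewrite addn0; exact.
have iS k : (k <= 4)%N -> P.-integrable setT (fun w => (S' w ^+ k)%:E).
  exact: (integrable_expr_le (n := 2)).
have iXm k : (k <= 4)%N -> P.-integrable setT (fun w => (X m w ^+ k)%:E).
  exact: (integrable_expr_le (n := 2)).
have prod i j : (i <= 4)%N -> (j <= 4)%N ->
    P.-integrable setT (fun w => (S' w ^+ i * X m w ^+ j)%:E) /\
    \int[P]_w (S' w ^+ i * X m w ^+ j) = \int[P]_w (S' w ^+ i) * \int[P]_w (X m w ^+ j).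
  move=> i4 j4.
  apply: (@integral_indep_mul _ _ _ P S'm (X m) (fun x => x ^+ i) (fun x => x ^+ j)) => //.
  - exact: iS.
  - exact: iXm.
have pw n w : S w ^+ n = \sum_(i < n.+1)
    ('C(n, i)%:R * c m ^+ i) * (S' w ^+ (n - i) * X m w ^+ i).
  rewrite /S big_ord_recr/= -/(S' w) exprDn; apply: eq_bigr => i _.
  by rewrite exprMn -mulr_natl; ring.
have En n : (n <= 4)%N ->
    P.-integrable setT (fun w => (S w ^+ n)%:E) /\
    \int[P]_w (S w ^+ n) = \sum_(i < n.+1)
    ('C(n, i)%:R * c m ^+ i) * (\int[P]_w (S' w ^+ (n - i)) * \int[P]_w (X m w ^+ i)).
  move=> n4.
  have [|h1 h2] := @Rintegral_lincomb P n.+1 (fun i => 'C(n, i)%:R * c m ^+ i)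
     (fun i w => S' w ^+ (n - i) * X m w ^+ i).
    move=> i ni; apply: (prod _ _ _ _).1; first by rewrite (leq_trans (leq_subr _ _)).
    by rewrite (leq_trans _ n4).
  split.
    by apply: eqfun_integrable h1 _ => w; rewrite pw.
  under eq_Rintegral do rewrite pw.
  rewrite h2; apply: eq_bigr => i _; congr (_ * _); rewrite (prod _ _ _ _).2//.
    by rewrite (leq_trans (leq_subr _ _)).
  by rewrite (leq_trans _ n4)// -ltnS.
have P0 : \int[P]_w (1 : R) = 1.
  by rewrite Rintegral_cst// mul1r; apply: (congr1 fine (probability_setT P)).
have e0 (Y : T -> R) : \int[P]_w (Y w ^+ 0) = 1 by under eq_Rintegral do rewrite expr0.
have e1 (Y : T -> R) : \int[P]_w (Y w ^+ 1) = \int[P]_w Y w by [].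
have QE : Q = Q' + c m ^+ 2 * v m by rewrite /Q big_ord_recr.
split.
- exact: (En 4%N isT).1.
- have := (En 1%N isT).2; rewrite e1 => ->.
  by rewrite !big_ord_recl big_ord0/= !e0 !e1 S1 X1; ring.
- rewrite (En 2%N isT).2 !big_ord_recl big_ord0/= !e0 !e1 S1 X1 X2 S2 QE.
  by rewrite /bump /= ?binn ?bin0; ring.
- rewrite (En 4%N isT).2 !big_ord_recl big_ord0/= !e0 !e1 S1 X1 X2 S2 X4 S4 QE.
  have [-> -> -> ->] : [/\ bump 0 0 = 1%N, bump 0 1 = 2%N, bump 0 2 = 3%N &
      bump 0 3 = 4%N] by [].
  have [-> -> ->] : [/\ 'C(4, 0) = 1%N, 'C(4, 2) = 6%N & 'C(4, 4) = 1%N] by [].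
  by ring.
Qed.
End fourth_moments.

Section polarization.
Context {d : measure_display} {T : measurableType d} {R : realType}.
Variable P : probability T R.
Variables (X : nat -> {mfun T >-> R}) (v : nat -> R).
Hypothesis iX : forall n, mutually_independent P (fun i : 'I_n => X i : T -> R).
Hypothesis X1 : forall i, \int[P]_w X i w = 0.
Hypothesis X2 : forall i, \int[P]_w (X i w ^+ 2) = v i.
Hypothesis IX4 : forall i, P.-integrable setT (fun w => (X i w ^+ 4)%:E).
Hypothesis X4 : forall i, \int[P]_w (X i w ^+ 4) = 3 * v i ^+ 2.
Notation S c m := (fun w => \sum_(i < m) c i * X i w).
Notation Q c e m := (\sum_(i < m) c i * e i * v i).

Lemma gaussian_sum_wick (c e : nat -> R) (m : nat) :
  [/\ P.-integrable setT (fun w => (S c m w * S e m w)%:E),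
      \int[P]_w (S c m w * S e m w) = Q c e m,
      P.-integrable setT (fun w => (S c m w ^+ 2 * S e m w ^+ 2)%:E) &
      \int[P]_w (S c m w ^+ 2 * S e m w ^+ 2) =
        Q c c m * Q e e m + 2 * Q c e m ^+ 2].
Proof.
have mS a : measurable_fun setT (S a m).
  by apply: measurable_sum => i; exact: measurable_funM.
(* Polarization: [4 ab = (a + b)^2 - (a - b)^2] and
   [12 a^2 b^2 = (a + b)^4 + (a - b)^4 - 2 a^4 - 2 b^4]. *)
pose k (i : nat) : nat -> R := nth (fun=> 0)
  [:: (fun i => c i + e i); (fun i => c i - e i); c; e] i.
have QE i : \sum_(j < m) k i j ^+ 2 * v j = nth 0
    [:: Q c c m + 2 * Q c e m + Q e e m; Q c c m - 2 * Q c e m + Q e e m;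
        Q c c m; Q e e m] i.
  case: i => [|[|[|[|i]]]]; rewrite /k/=.
  - by rewrite mulr_sumr -!big_split; apply: eq_bigr => j _ /=; ring.
  - by rewrite mulr_sumr -sumrB -big_split; apply: eq_bigr => j _ /=; ring.
  - by apply: eq_bigr.
  - by apply: eq_bigr.
  - by rewrite !nth_nil big1// => j _; rewrite expr0n mul0r.
have SE i w : S (k i) m w = nth 0 [:: S c m w + S e m w; S c m w - S e m w;
    S c m w; S e m w] i.
  case: i => [|[|[|[|i]]]]; rewrite /k//=.
  - by rewrite -big_split; apply: eq_bigr => j _ /=; ring.
  - by rewrite -sumrB; apply: eq_bigr => j _ /=; ring.
  - by rewrite !nth_nil big1// => j _; rewrite mul0r.
have mom i := gaussian_sum_moments (k i) iX X1 X2 IX4 X4 m.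
have i4 i : P.-integrable setT (fun w => (S (k i) m w ^+ 4)%:E) by have [] := mom i.
have i2 i : P.-integrable setT (fun w => (S (k i) m w ^+ 2)%:E).
  exact: (integrable_expr_le (n := 2)).
have e2 i : \int[P]_w (S (k i) m w ^+ 2) = \sum_(j < m) k i j ^+ 2 * v j.
  by have [] := mom i.
have e4 i : \int[P]_w (S (k i) m w ^+ 4) = 3 * (\sum_(j < m) k i j ^+ 2 * v j) ^+ 2.
  by have [] := mom i.
have [l1 l2] := @Rintegral_lincomb _ _ _ P 2 (nth 0 [:: 4^-1; - 4^-1])
  (fun i w => S (k i) m w ^+ 2) (fun i _ => i2 i).
have [f1 f2] := @Rintegral_lincomb _ _ _ P 4
  (nth 0 [:: 12^-1; 12^-1; - 6^-1; - 6^-1])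
  (fun i w => S (k i) m w ^+ 4) (fun i _ => i4 i).
have lE w : \sum_(i < 2) nth 0 [:: 4^-1; - 4^-1] i * S (k i) m w ^+ 2 =
    S c m w * S e m w.
  by under eq_bigr do rewrite SE; rewrite !big_ord_recl big_ord0/=; field.
have fE w : \sum_(i < 4) nth 0 [:: 12^-1; 12^-1; - 6^-1; - 6^-1] i *
    S (k i) m w ^+ 4 = S c m w ^+ 2 * S e m w ^+ 2.
  by under eq_bigr do rewrite SE; rewrite !big_ord_recl big_ord0/=; field.
split.
- by apply: eqfun_integrable l1 _ => w; rewrite lE.
- under eq_Rintegral do rewrite -lE.
  rewrite l2; under eq_bigr do rewrite e2 QE.
  by rewrite !big_ord_recl big_ord0/=; field.
- by apply: eqfun_integrable f1 _ => w; rewrite fE.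
- under eq_Rintegral do rewrite -fE.
  rewrite f2; under eq_bigr do rewrite e4 QE.
  by rewrite !big_ord_recl big_ord0/=; field.
Qed.
End polarization.

(** * The Wiener integral *)

Section grid.
Context {R : realType}.

(** Independence of increments is stated along strictly increasing infinite sequences, whereas the
    knots of step functions may repeat and, for two step functions, interleave. Sorting them without
    repetition gives a common refinement. *)
Lemma increasing_grid (s : seq R) : exists2 t : nat -> R,
  (forall i, t i < t i.+1) & {in s, forall x, exists2 p, (p <= size s)%N & x = t p}.
Proof.
pose r := sort <=%O (undup s).
have rs : sorted <%R r.
  by rewrite sort_lt_sorted undup_uniq.
(* Beyond the sorted knots the grid continues above the last one with unit spacing, which keeps it
   strictly increasing forever. *)
exists (fun i => if (i < size r)%N then nth 0 r i else last 0 r + i.+1%:R).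
  move=> i; case: ifPn => ir; case: ifPn => iSr.
  - by rewrite (sorted_ltn_nth lt_trans)// inE.
  - have -> : nth 0 r i = last 0 r.
      suff sr : size r = i.+1 by rewrite (last_nth 0) sr.
      by apply/eqP; rewrite eqn_leq ir leqNgt iSr.
    by rewrite ltrDl ltr0n.
  - by rewrite (ltn_trans _ iSr) in ir.
  - by rewrite ltrD2l ltr_nat.
move=> x xs; have xr : x \in r by rewrite mem_sort mem_undup.
exists (index x r); last by rewrite index_mem xr nth_index.
rewrite (leq_trans (ltnW _) (size_undup s))//.
by rewrite -(size_sort <=%O) index_mem.
Qed.

Variables (t : nat -> R) (n : nat).
Hypothesis t_incr : forall i, t i < t i.+1.

Lemma grid_lt : {mono t : i j / (i < j)%N >-> i < j}.
Proof. exact: (leW_mono (Order.NatMonotonyTheory.incnP t_incr)). Qed.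

(** Telescoping over the cells between p and q. A cell is selected by testing its right endpoint
    [t j.+1], which suits left-open, right-closed intervals. *)
Lemma increment_grid (F : R -> R) p q : (p <= q)%N -> (q <= n)%N ->
  F (t q) - F (t p) =
  \sum_(j < n) \1_`]t p, t q] (t j.+1) * (F (t j.+1) - F (t j)).
Proof.
move=> pq qn; rewrite -(telescope_sumr (fun i => F (t i)) pq).
rewrite -(big_mkord xpredT (fun j => \1_`]t p, t q] (t j.+1) * (F (t j.+1) - F (t j)))).
rewrite [RHS](big_cat_nat (n := p))//=; last exact: leq_trans qn.
rewrite [X in _ = _ + X](big_cat_nat (n := q))//=.
have inE' j : (t j.+1 \in `]t p, t q]%classic) = (p <= j < q)%N.
  rewrite mem_setE in_itv/= grid_lt ltnS; congr andb.
  by rewrite leNgt grid_lt ltnS -ltnNge.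
rewrite [X in _ = X + _]big_nat [X in _ = X + _]big1 ?add0r; last first.
  by move=> j /andP[_ jp]; rewrite indicE inE' leqNgt jp mul0r.
rewrite [X in _ = _ + X]big_nat [X in _ = _ + X]big1 ?addr0; last first.
  by move=> j /andP[qj _]; rewrite indicE inE' [(j < q)%N]ltnNge qj andbF mul0r.
rewrite big_nat [RHS]big_nat; apply: eq_bigr => j jpq.
by rewrite indicE inE' jpq mul1r.
Qed.
End grid.

Section step_functions.
Context {R : realType}.
Notation mu := (@lebesgue_measure R).

(** Presents an indicator as an increment of the function y |-> [x <= y]. Thus [step_eval] at a
    point has the same form as [step_integral], and one regridding lemma, for an arbitrary [F],
    serves both. *)
Lemma indic_itvoc (a b x : R) : a <= b ->
  \1_`]a, b] x = (x <= b)%R%:R - (x <= a)%R%:R :> R.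
Proof.
move=> ab; rewrite indicE mem_setE in_itv/=.
case: (leP x a) => /= [xa|ax]; last by rewrite subr0.
by rewrite (le_trans xa ab) subrr.
Qed.

Variables (t : nat -> R) (n : nat).
Hypothesis t_incr : forall i, t i < t i.+1.

Definition on_grid (phi : step_fun R) := forall i, (i <= step_size phi)%N ->
  exists2 p, (p <= n)%N & step_knot phi i = t p.

Lemma step_sum_grid (phi : step_fun R) (F : R -> R) : on_grid phi ->
  \sum_(i < step_size phi)
    step_coef phi i * (F (step_knot phi i.+1) - F (step_knot phi i)) =
  \sum_(j < n) step_eval phi (t j.+1) * (F (t j.+1) - F (t j)).
Proof.
move=> g; under [RHS]eq_bigr do rewrite /step_eval mulr_suml.
rewrite exchange_big/=; apply: eq_bigr => i _.
have [p pn kp] := g i (ltnW (ltn_ord i)); have [q qn kq] := g i.+1 (ltn_ord i).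
rewrite kp kq (increment_grid (n := n) t_incr)// ?mulr_sumr.
  by apply: eq_bigr => j _; rewrite mulrA.
by rewrite leqNgt -(grid_lt t_incr) -kp -kq -leNgt step_knot_nd.
Qed.

Lemma step_eval_grid (phi : step_fun R) (x : R) : on_grid phi ->
  step_eval phi x =
  \sum_(j < n) step_eval phi (t j.+1) * \1_`]t j, t j.+1] x.
Proof.
move=> g; rewrite {1}/step_eval.
under eq_bigr do rewrite indic_itvoc ?step_knot_nd//.
rewrite (step_sum_grid (fun y => (x <= y)%R%:R) g).
by apply: eq_bigr => j _; rewrite indic_itvoc// ltW.
Qed.

Lemma grid_indic_mul (c e : nat -> R) (x : R) :
  (\sum_(j < n) c j * \1_`]t j, t j.+1] x) *
  (\sum_(j < n) e j * \1_`]t j, t j.+1] x) =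
  \sum_(j < n) c j * e j * \1_`]t j, t j.+1] x.
Proof.
rewrite mulr_suml; apply: eq_bigr => j _; rewrite (bigD1 j)//= mulrDr.
rewrite mulr_sumr big1 ?addr0.
  by rewrite !indicE; case: (x \in _); rewrite ?mulr1// !mulr0.
move=> k kj; rewrite mulrACA !indicE !mem_setE !in_itv/= -natrM mulnb.
suff /negbTE -> : ~~ ((t j < x <= t j.+1) && (t k < x <= t k.+1)).
  by rewrite mulr0.
apply/negP => /andP[/andP[jx xj] /andP[kx xk]].
have := lt_le_trans kx xj; have := lt_le_trans jx xk.
rewrite !(grid_lt t_incr) !ltnS => jk kj'.
by case/negP: kj; apply/eqP/val_inj/eqP; rewrite eqn_leq jk kj'.
Qed.

Lemma integral_step_mul (phi psi : step_fun R) : on_grid phi -> on_grid psi ->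
  mu.-integrable setT (fun x => (step_eval phi x * step_eval psi x)%:E) /\
  \int[mu]_x (step_eval phi x * step_eval psi x) =
  \sum_(j < n) step_eval phi (t j.+1) * step_eval psi (t j.+1) * (t j.+1 - t j).
Proof.
move=> gphi gpsi.
have pE x : step_eval phi x * step_eval psi x = \sum_(j < n)
    step_eval phi (t j.+1) * step_eval psi (t j.+1) * \1_`]t j, t j.+1] x.
  rewrite (step_eval_grid x gphi) (step_eval_grid x gpsi).
  exact: (grid_indic_mul (fun j => step_eval phi (t j.+1))
    (fun j => step_eval psi (t j.+1))).
have [h1 h2] := @Rintegral_lincomb _ _ _ mu n
  (fun j => step_eval phi (t j.+1) * step_eval psi (t j.+1))
  (fun j => \1_`]t j, t j.+1]) (fun j _ => integrable_indic_itv (t j) (t j.+1) false false).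
split.
  by apply: eqfun_integrable h1 _ => x; rewrite pE.
under eq_Rintegral do rewrite pE.
rewrite h2; apply: eq_bigr => j _; congr (_ * _).
by rewrite /Rintegral integral_indic//= setIT lebesgue_measure_itv/= lte_fin t_incr.
Qed.
End step_functions.

Section wiener_step.
Context {d : measure_display} {T : measurableType d} {R : realType}.
Variables (P : probability T R) (W : R -> {RV P >-> R}).
Hypothesis hW : standard_wiener W.
Notation mu := (@lebesgue_measure R).

(** On a grid common to both step functions, the two integrals are linear combinations of the same
    independent normal increments, with variances [t i.+1 - t i]; the quadratic sums of the Gaussian
    formula become Lebesgue integrals. *)
Lemma wiener_step_wick (phi psi : step_fun R) :
  let C f g := \int[mu]_x (step_eval f x * step_eval g x) in
  let J f := step_integral W f in
  [/\ P.-integrable setT (fun w => (J phi w * J psi w)%:E),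
      \int[P]_w (J phi w * J psi w) = C phi psi,
      P.-integrable setT (fun w => (J phi w ^+ 2 * J psi w ^+ 2)%:E) &
      \int[P]_w (J phi w ^+ 2 * J psi w ^+ 2) =
        C phi phi * C psi psi + 2 * C phi psi ^+ 2].
Proof.
move=> C J.
pose knots (f : step_fun R) := [seq step_knot f i | i <- iota 0 (step_size f).+1].
have [t t_incr tk] := increasing_grid (knots phi ++ knots psi).
set n := size _ in tk.
have grid f : {subset knots f <= knots phi ++ knots psi} -> on_grid t n f.
  move=> fs i ip; apply: tk; apply: fs; apply/mapP; exists i => //.
  by rewrite mem_iota.
have gphi : on_grid t n phi by apply: grid => x xp; rewrite mem_cat xp.
have gpsi : on_grid t n psi by apply: grid => x xp; rewrite mem_cat xp orbT.
pose dW i w := W (t i.+1) w - W (t i) w.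
have mdW i : measurable_fun setT (dW i) by exact: measurable_funB.
pose X i : {mfun T >-> R} := HB.pack (dW i) (isMeasurableFun.Build _ _ _ _ _ (mdW i)).
pose v i := t i.+1 - t i.
have v0 i : 0 < v i by rewrite subr_gt0.
have XN i A : measurable A -> P (X i @^-1` A) = normal_prob 0 (Num.sqrt (v i)) A.
  exact: wiener_normal.
have mom i := normal_variable_moments (v0 i) (XN i).
have X1 i : \int[P]_w X i w = 0 by have [] := mom i.
have X2 i : \int[P]_w (X i w ^+ 2) = v i.
  by have [_ + _] := mom i; rewrite /Rintegral => ->.
have X4 i : \int[P]_w (X i w ^+ 4) = 3 * v i ^+ 2.
  by have [_ _] := mom i; rewrite /Rintegral => ->.
have IX4 i : P.-integrable setT (fun w => (X i w ^+ 4)%:E).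
  apply/integrableP; split.
    by apply/measurable_EFinP; exact: measurable_funX.
  rewrite (eq_integral (fun w => (X i w ^+ 4)%:E)).
    by have [_ _ ->] := mom i; exact: ltry.
  by move=> w _; rewrite gee0_abs// lee_fin exprn_even_ge0.
have iX m : mutually_independent P (fun i : 'I_m => X i : T -> R).
  exact: (@wiener_indep _ _ _ _ _ hW m t t_incr).
have JE f : on_grid t n f ->
    J f = (fun w => \sum_(j < n) step_eval f (t j.+1) * X j w).
  by move=> gf; apply/funext => w; exact: (step_sum_grid t_incr (fun s => W s w) gf).
have CE f g : on_grid t n f -> on_grid t n g ->
    C f g = \sum_(j < n) step_eval f (t j.+1) * step_eval g (t j.+1) * v j.
  by move=> gf gg; exact: (integral_step_mul t_incr gf gg).2.
have [] := gaussian_sum_wick iX X1 X2 IX4 X4 (fun j => step_eval phi (t j.+1))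
  (fun j => step_eval psi (t j.+1)) n.
rewrite -(CE _ _ gphi gphi) -(CE _ _ gphi gpsi) -(CE _ _ gpsi gpsi).
by rewrite (JE _ gphi) (JE _ gpsi).
Qed.
End wiener_step.

(** * Mean square convergence *)

Section L2_convergence.
Context {d : measure_display} {T : measurableType d} {R : realType}.
Variable mu : {measure set T -> \bar R}.
Notation sq_integrable f := (mu.-integrable setT (fun x => (f x ^+ 2)%:E)).

Lemma sq_integrable_mul (f g : T -> R) :
  measurable_fun setT f -> measurable_fun setT g ->
  sq_integrable f -> sq_integrable g ->
  mu.-integrable setT (fun x => (f x * g x)%:E).
Proof.
move=> mf mg If Ig; apply: (le_integrable _ _ _ (integrableD measurableT If Ig)) => //.
  by apply/measurable_EFinP; exact: measurable_funM.
move=> x _; rewrite /= lee_fin [leRHS]ger0_norm ?addr_ge0 ?sqr_ge0//.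
by rewrite ler_norml; apply/andP; split; nra.
Qed.

Lemma sq_integrableB (f g : T -> R) :
  measurable_fun setT f -> measurable_fun setT g ->
  sq_integrable f -> sq_integrable g -> sq_integrable (fun x => f x - g x).
Proof.
move=> mf mg If Ig.
apply: (le_integrable _ _ _
  (integrableZl measurableT 2 (integrableD measurableT If Ig))) => //.
  by apply/measurable_EFinP/measurable_funX; exact: measurable_funB.
move=> x _; rewrite /= lee_fin ger0_norm ?sqr_ge0// ger0_norm; last first.
  by rewrite mulr_ge0// addr_ge0 ?sqr_ge0.
rewrite -subr_ge0 (_ : _ - _ = (f x + g x) ^+ 2) ?sqr_ge0//; ring.
Qed.

(** Write f = (f - phi n) + phi n for a single [n] at which the L^2 distance is finite. *)
Lemma L2_limit_sq_integrable (f : T -> R) (phi : nat -> T -> R) :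
  measurable_fun setT f -> (forall n, measurable_fun setT (phi n)) ->
  (forall n, sq_integrable (phi n)) ->
  (\int[mu]_x ((f x - phi n x) ^+ 2)%:E)%E @[n --> \oo] --> 0%E ->
  sq_integrable f.
Proof.
move=> mf mphi Iphi cphi.
have [n ndiff] : exists n, (\int[mu]_x ((f x - phi n x) ^+ 2)%:E < +oo)%E.
  have /fine_cvgP[[N _ /(_ N (leqnn N)) fN] _] := cphi.
  by exists N; rewrite ltey_eq fN.
have Id : sq_integrable (fun x => f x - phi n x).
  apply/integrableP; split.
    by apply/measurable_EFinP/measurable_funX; exact: measurable_funB.
  by under eq_integral do rewrite gee0_abs ?lee_fin ?sqr_ge0//.
have mN : measurable_fun setT (fun x => - phi n x) by exact: measurable_funN.
apply: eqfun_integrable (sq_integrableB _ mN Id _) _ => //.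
- exact: measurable_funB.
- by apply: eqfun_integrable (Iphi n) _ => x; rewrite sqrrN.
- by move=> x; rewrite opprK subrK.
Qed.

(** Continuity of the L^2 inner product. Here the weighted inequality |y z| <= y^2 / eta + eta z^2
    plays the part of Cauchy-Schwarz: the distances [A n], [B n] receive the large weight and the
    fixed norms [F], [G] the small one. *)
Lemma L2_cvg_mul (f g : T -> R) (phi psi : nat -> T -> R) :
  measurable_fun setT f -> measurable_fun setT g ->
  (forall n, measurable_fun setT (phi n)) ->
  (forall n, measurable_fun setT (psi n)) ->
  (forall n, sq_integrable (phi n)) -> (forall n, sq_integrable (psi n)) ->
  (\int[mu]_x ((f x - phi n x) ^+ 2)%:E)%E @[n --> \oo] --> 0%E ->
  (\int[mu]_x ((g x - psi n x) ^+ 2)%:E)%E @[n --> \oo] --> 0%E ->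
  \int[mu]_x (phi n x * psi n x) @[n --> \oo] --> \int[mu]_x (f x * g x).
Proof.
move=> mf mg mphi mpsi Iphi Ipsi cphi cpsi.
have If := L2_limit_sq_integrable mf mphi Iphi cphi.
have Ig := L2_limit_sq_integrable mg mpsi Ipsi cpsi.
pose F := \int[mu]_x (f x ^+ 2); pose G := \int[mu]_x (g x ^+ 2).
pose A n := \int[mu]_x ((f x - phi n x) ^+ 2).
pose B n := \int[mu]_x ((g x - psi n x) ^+ 2).
have cA : A n @[n --> \oo] --> 0 by exact: fine_cvg cphi.
have cB : B n @[n --> \oo] --> 0 by exact: fine_cvg cpsi.
have F0 : 0 <= F by apply: Rintegral_ge0 => x _; exact: sqr_ge0.
have G0 : 0 <= G by apply: Rintegral_ge0 => x _; exact: sqr_ge0.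
have bound (eta : R) n : 0 < eta ->
    `|\int[mu]_x (f x * g x) - \int[mu]_x (phi n x * psi n x)| <=
    (1 + eta^-1) * A n + (1 + eta^-1) * B n + eta * F + eta * G.
  move=> eta0.
  have Ifg := sq_integrable_mul mf mg If Ig.
  have Ipp := sq_integrable_mul (mphi n) (mpsi n) (Iphi n) (Ipsi n).
  rewrite -RintegralB//.
  have IB := integrableB measurableT Ifg Ipp.
  apply: le_trans (le_normr_Rintegral measurableT IB) _.
  have [h1 h2] := @Rintegral_lincomb _ _ _ mu 4
    (nth 0 [:: 1 + eta^-1; 1 + eta^-1; eta; eta])
    (nth (fun=> 0) [:: (fun x => (f x - phi n x) ^+ 2);
       (fun x => (g x - psi n x) ^+ 2); (fun x => f x ^+ 2); (fun x => g x ^+ 2)])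
    (fun i i4 => ltac:(move: i i4 => [|[|[|[|//]]]] _;
      [exact: sq_integrableB|exact: sq_integrableB|exact: If|exact: Ig])).
  move: h2; rewrite !big_ord_recl big_ord0/= addr0 !addrA => <-.
  apply: le_Rintegral => //.
    by apply: integrable_norm IB.
  move=> x _; rewrite !big_ord_recl big_ord0/= addr0.
  set a := f x; set b := g x; set p := phi n x; set q := psi n x.
  have -> : a * b - p * q = (a - p) * b + a * (b - q) - (a - p) * (b - q) by ring.
  set u := a - p; set v := b - q.
  have amgm (y z : R) : `|y * z| <= eta^-1 * y ^+ 2 + eta * z ^+ 2.
    have e0 : 0 < eta^-1 by rewrite invr_gt0.
    have ee : eta^-1 * eta = 1 by rewrite mulVf// gt_eqF.
    have h : 0 <= eta * (eta^-1 * y - z) ^+ 2 by rewrite mulr_ge0 ?sqr_ge0 ?ltW.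
    have h' : 0 <= eta * (eta^-1 * y + z) ^+ 2 by rewrite mulr_ge0 ?sqr_ge0 ?ltW.
    have E : eta^-1 * y ^+ 2 + eta * z ^+ 2 - (y * z) *+ 2 = eta * (eta^-1 * y - z) ^+ 2.
      by field; rewrite gt_eqF.
    have E' : eta^-1 * y ^+ 2 + eta * z ^+ 2 + (y * z) *+ 2 = eta * (eta^-1 * y + z) ^+ 2.
      by field; rewrite gt_eqF.
    have p1 : 0 <= eta^-1 * y ^+ 2 by rewrite mulr_ge0 ?sqr_ge0 ?ltW.
    have p2 : 0 <= eta * z ^+ 2 by rewrite mulr_ge0 ?sqr_ge0 ?ltW.
    rewrite ler_norml; apply/andP; split; lra.
  have := amgm u b; have := amgm v a; have uv : `|u * v| <= u ^+ 2 + v ^+ 2.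
    by rewrite ler_norml; apply/andP; split; nra.
  rewrite [v * a]mulrC => va ub.
  apply: le_trans (ler_normB _ _) _.
  apply: le_trans (lerD (ler_normD _ _) (lexx _)) _.
  lra.
apply/cvgrPdist_le => e e0.
(* Half of [e] goes to the two terms in [eta], a quarter to each of [K * A n] and [K * B n]. The
   summand 1 keeps the denominator positive when both norms vanish. *)
pose eta := e / (2 * (F + G + 1)).
have FG : 0 < F + G + 1 by lra.
have eta0 : 0 < eta by rewrite divr_gt0// mulr_gt0.
pose K := 1 + eta^-1; have K0 : 0 < K by rewrite addr_gt0// invr_gt0.
pose e' := e / (4 * K).
have e'0 : 0 < e' by rewrite divr_gt0// mulr_gt0.
have small (u : nat -> R) : u n @[n --> \oo] --> 0 -> \forall n \near \oo, u n <= e'.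
  move=> /cvgrPdist_le/(_ _ e'0); apply: filterS => n.
  by rewrite sub0r normrN => /(le_trans (ler_norm _)).
near=> n; apply: le_trans (bound eta n eta0) _.
have An : A n <= e' by near: n; exact: small cA.
have Bn : B n <= e' by near: n; exact: small cB.
have KA : K * A n <= e / 4.
  have -> : e / 4 = K * e' by rewrite /e'; field; rewrite gt_eqF.
  by rewrite ler_pM2l.
have KB : K * B n <= e / 4.
  have -> : e / 4 = K * e' by rewrite /e'; field; rewrite gt_eqF.
  by rewrite ler_pM2l.
have eFG : eta * F + eta * G <= e / 2.
  have -> : e / 2 = eta * (F + G + 1) by rewrite /eta; field; rewrite gt_eqF.
  by rewrite -mulrDr ler_pM2l// lerDl.
rewrite -/K; lra.
Unshelve. all: by end_near.
Qed.
End L2_convergence.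

Lemma cvg_sqr_dist {R : realType} (u : nat -> R) (l : R) :
  (u n - l) ^+ 2 @[n --> \oo] --> 0 -> u n @[n --> \oo] --> l.
Proof.
move=> ul; apply/cvgrPdist_le => e e0.
have e2 : 0 < e ^+ 2 by rewrite exprn_gt0.
have /cvgrPdist_le/(_ _ e2) := ul; apply: filterS => n.
rewrite sub0r normrN normrX => De.
by rewrite distrC -(ler_pXn2r (n := 2))// ?nnegrE// ltW.
Qed.

(** * Almost everywhere convergence *)

Section ae_convergence.
Context {d : measure_display} {T : measurableType d} {R : realType}.
Variable mu : {measure set T -> \bar R}.

(** The series of the [F n] has integral at most [M], hence is finite almost everywhere, and the
    terms of a convergent series tend to 0. Every almost sure statement below goes through this
    argument. *)
Lemma ae_cvg0_summable (F : nat -> T -> R) (a : nat -> R) (M : R) :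
  (forall n, measurable_fun setT (F n)) -> (forall n x, 0 <= F n x) ->
  (forall n, (\int[mu]_x (F n x)%:E <= (a n)%:E)%E) ->
  (forall n, \sum_(k < n) a k <= M) ->
  {ae mu, forall x, F n x @[n --> \oo] --> 0}.
Proof.
move=> mF F0 Fa aM.
pose G x := (\big[+%E/0%E]_(0 <= n <oo) (F n x)%:E)%E.
have G0 x : (0 <= G x)%E by apply: nneseries_ge0 => n _ _; rewrite lee_fin.
have mG : measurable_fun setT G.
  apply: ge0_emeasurable_sum => //.
  - by move=> n x _; rewrite lee_fin.
  - by move=> n _; apply/measurable_EFinP.
have GM : (\int[mu]_x G x <= M%:E)%E.
  rewrite integral_nneseries//; last 2 first.
  - by move=> n; exact/measurable_EFinP.
  - by move=> n x _; rewrite lee_fin.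
  apply: lime_le.
    apply: is_cvg_nneseries => n _ _; apply: integral_ge0 => x _.
    by rewrite lee_fin.
  apply: nearW => n.
  rewrite (@le_trans _ _ (\sum_(0 <= k < n) (a k)%:E)%E)//; first exact: lee_sum.
  by rewrite sumEFin big_mkord lee_fin.
have IG : mu.-integrable setT G.
  apply/integrableP; split => //.
  under eq_integral do rewrite gee0_abs//.
  by rewrite (le_lt_trans GM)// ltry.
apply: filterS (integrable_ae measurableT IG) => x /(_ Logic.I) Gx.
apply: cvg_series_cvg_0; apply: nondecreasing_is_cvgn.
  apply/nondecreasing_seqP => n.
  by rewrite /series/= big_nat_recr//= lerDl.
exists (fine (G x)) => _ [n _ <-].
rewrite /series/= -lee_fin fineK// -sumEFin.
by apply: nneseries_lim_ge => k _ _; rewrite lee_fin.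
Qed.

Lemma measurable_fun_limn_einf (H : nat -> T -> \bar R) :
  (forall n, measurable_fun setT (H n)) ->
  measurable_fun setT (fun x => limn_einf (H ^~ x)).
Proof.
move=> mH; apply: (emeasurable_fun_cvg (fun n x => einfs (H ^~ x) n)).
  exact: measurable_fun_einfs.
by move=> x _; rewrite limn_einf_lim; exact: is_cvg_einfs.
Qed.

Lemma limn_einf_ge0 (u : nat -> \bar R) : (forall n, 0 <= u n)%E ->
  (0 <= limn_einf u)%E.
Proof.
move=> u0; rewrite limn_einf_lim; apply: lime_ge; first exact: is_cvg_einfs.
by apply: nearW => n; apply: le_ereal_inf_tmp => _ [m _ <-].
Qed.

Lemma sum_half_expr_le n : \sum_(k < n) 2^-1 ^+ k <= 2 :> R.
Proof.
suff -> : \sum_(k < n) 2^-1 ^+ k = 2 - 2 * 2^-1 ^+ n :> R.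
  by rewrite gerBl mulr_ge0// exprn_ge0// invr_ge0.
elim: n => [|n IH]; first by rewrite big_ord0 expr0 mulr1 subrr.
by rewrite big_ord_recr/= IH exprS; field.
Qed.

(** Fatou's lemma wants pointwise convergence. A subsequence along which the squared distances are
    at most 2^-k converges almost everywhere, and the integrals along it still tend to [L]. *)
Lemma integral_sqr_mul_fatou (X Y : T -> R) (X_ Y_ : nat -> T -> R) (L : \bar R) :
  measurable_fun setT X -> measurable_fun setT Y ->
  (forall n, measurable_fun setT (X_ n)) ->
  (forall n, measurable_fun setT (Y_ n)) ->
  (\int[mu]_x ((X x - X_ n x) ^+ 2)%:E)%E @[n --> \oo] --> 0%E ->
  (\int[mu]_x ((Y x - Y_ n x) ^+ 2)%:E)%E @[n --> \oo] --> 0%E ->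
  (\int[mu]_x (X_ n x ^+ 2 * Y_ n x ^+ 2)%:E)%E @[n --> \oo] --> L ->
  (\int[mu]_x (X x ^+ 2 * Y x ^+ 2)%:E <= L)%E.
Proof.
move=> mX mY mX_ mY_ cX cY cL.
(* Adding the two squared errors lets one subsequence serve both factors. *)
pose D n x := (X x - X_ n x) ^+ 2 + (Y x - Y_ n x) ^+ 2.
have mD n : measurable_fun setT (D n).
  by apply: measurable_funD; apply: measurable_funX; exact: measurable_funB.
have cD : (\int[mu]_x (D n x)%:E)%E @[n --> \oo] --> 0%E.
  have DE n : (\int[mu]_x (D n x)%:E = \int[mu]_x ((X x - X_ n x) ^+ 2)%:E +
      \int[mu]_x ((Y x - Y_ n x) ^+ 2)%:E)%E.
    under eq_integral do rewrite EFinD.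
    rewrite ge0_integralD//.
    - by move=> x _; rewrite lee_fin sqr_ge0.
    - by apply/measurable_EFinP/measurable_funX; exact: measurable_funB.
    - by move=> x _; rewrite lee_fin sqr_ge0.
    - by apply/measurable_EFinP/measurable_funX; exact: measurable_funB.
  suff : (\int[mu]_x (D n x)%:E)%E @[n --> \oo] --> (0 + 0)%E by rewrite adde0.
  have -> : (fun n => (\int[mu]_x (D n x)%:E)%E) =
      ((fun n => \int[mu]_x ((X x - X_ n x) ^+ 2)%:E) \+
       (fun n => \int[mu]_x ((Y x - Y_ n x) ^+ 2)%:E))%E.
    by apply/funext => n; exact: DE.
  by apply: cvgeD.
have [s sP] : {s : nat -> nat & forall k, (k <= s k)%N /\
    (\int[mu]_x (D (s k) x)%:E <= (2^-1 ^+ k)%:E)%E}.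
  apply: (@choice _ _ (fun k n => (k <= n)%N /\
    (\int[mu]_x (D n x)%:E <= (2^-1 ^+ k)%:E)%E)) => k.
  have k0 : 0 < 2^-1 ^+ k :> R by rewrite exprn_gt0.
  have /fine_cvgP[fD /cvgrPdist_le/(_ _ k0) nD] := cD.
  near \oo => n; exists n; split; first by near: n; exists k.
  have /fineK <- : (\int[mu]_x (D n x)%:E)%E \is a fin_num by near: n.
  rewrite lee_fin; have : `|0 - fine (\int[mu]_x (D n x)%:E)| <= 2^-1 ^+ k.
    by near: n.
  by rewrite sub0r normrN => /(le_trans (ler_norm _)).
have aeD : {ae mu, forall x, D (s n) x @[n --> \oo] --> 0}.
  apply: (@ae_cvg0_summable _ (fun k => 2^-1 ^+ k) 2) => //.
  - by move=> n x; rewrite addr_ge0 ?sqr_ge0.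
  - by move=> k; have [] := sP k.
  - exact: sum_half_expr_le.
have cs : s n @[n --> \oo] --> \oo.
  apply/cvgnyPge => N; near=> n; rewrite (leq_trans _ (sP n).1)//.
  by near: n; exists N.
pose H n x := (X_ (s n) x ^+ 2 * Y_ (s n) x ^+ 2)%:E.
have mH n : measurable_fun setT (H n).
  by apply/measurable_EFinP/measurable_funM; exact: measurable_funX.
have aeH : {ae mu, forall x, limn_einf (H ^~ x) = (X x ^+ 2 * Y x ^+ 2)%:E}.
  apply: filterS aeD => x Dx.
  have sq0 (u : nat -> R) (l : R) : (forall n, (l - u n) ^+ 2 <= D (s n) x) ->
      u n @[n --> \oo] --> l.
    move=> uD; apply/cvg_sqr_dist/(squeeze_cvgr _ (cvg_cst 0) Dx).
    by apply: nearW => n; rewrite sqr_ge0 -sqrrN opprB uD.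
  have cXx : X_ (s n) x @[n --> \oo] --> X x.
    by apply: sq0 => n; rewrite lerDl sqr_ge0.
  have cYx : Y_ (s n) x @[n --> \oo] --> Y x.
    by apply: sq0 => n; rewrite lerDr sqr_ge0.
  apply: (cvg_limn_einf_sup _).1; apply/cvg_EFin; first exact: nearW.
  apply: cvgM; [by apply: cvgM|by apply: cvgM].
rewrite (_ : (\int[mu]_x _)%E = (\int[mu]_x limn_einf (H ^~ x))%E); last first.
  apply: ge0_ae_eq_integral => //.
  - by apply/measurable_EFinP/measurable_funM; exact: measurable_funX.
  - exact: measurable_fun_limn_einf.
  - by move=> x _; rewrite lee_fin mulr_ge0 ?sqr_ge0.
  - by move=> x _; apply: limn_einf_ge0 => n; rewrite lee_fin mulr_ge0 ?sqr_ge0.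
  - by apply: filterS aeH => x ->.
apply: le_trans (fatou mu measurableT mH _) _.
  by move=> n x _; rewrite lee_fin mulr_ge0 ?sqr_ge0.
have cH : (\int[mu]_x H n x)%E @[n --> \oo] --> L.
  exact: (cvg_comp _ _ cs cL).
by rewrite (cvg_limn_einf_sup cH).1.
Unshelve. all: by end_near.
Qed.
End ae_convergence.

Section kernel.
Context {R : realType}.
Variable theta : R.
Hypothesis theta0 : 0 < theta.
Notation mu := (@lebesgue_measure R).

Lemma measurable_ou_kernel t : measurable_fun setT (ou_kernel theta t).
Proof.
apply: measurable_funM; last exact: measurable_indic.
by apply: measurableT_comp => //; apply: measurable_funM => //; exact: measurable_funB.
Qed.

(** Recognising a reflected exponential density of rate 2 theta in the product reduces the
    covariance integral to the normalisation of the exponential law. *)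
Lemma ou_kernel_mul (s t x : R) : s <= t ->
  ou_kernel theta t x * ou_kernel theta s x =
  expR (- theta * (t - s)) / (2 * theta) * exponential_pdf (2 * theta) (s - x).
Proof.
move=> st; rewrite /ou_kernel !indicE !mem_setE !in_itv/=.
rewrite /exponential_pdf patchE mem_setE in_itv/= andbT subr_ge0.
have [xs|] := leP x s; last by rewrite !mulr0.
rewrite (le_trans xs st) !mulr1 -expRD.
have -> : - theta * (t - x) + - theta * (s - x) =
  - theta * (t - s) + - (2 * theta) * (s - x) by ring.
by rewrite expRD; field; rewrite gt_eqF.
Qed.

Lemma integral_ou_kernel_mul (s t : R) :
  \int[mu]_x (ou_kernel theta t x * ou_kernel theta s x) =
  expR (- theta * `|t - s|) / (2 * theta).
Proof.
wlog st : s t / s <= t.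
  move=> H; have [|ts] := leP s t; first exact: H.
  rewrite distrC -(H _ _ (ltW ts)).
  by apply: eq_Rintegral => x _; rewrite mulrC.
have t20 : 0 < 2 * theta by rewrite mulr_gt0.
rewrite ger0_norm ?subr_ge0// /Rintegral.
under eq_integral do rewrite ou_kernel_mul// EFinM.
have mp := @measurable_exponential_pdf R (2 * theta).
have p0 := @exponential_pdf_ge0 R (2 * theta) (ltW t20).
rewrite ge0_integralZl//; last 3 first.
- apply/measurable_EFinP; apply: measurableT_comp => //.
  exact: measurable_funB.
- by move=> x _; rewrite lee_fin.
- by rewrite lee_fin divr_ge0 ?expR_ge0// ltW.
rewrite (ge0_lebesgue_integral_reflect s (f := EFin \o exponential_pdf (2 * theta))).
- by rewrite integral_exponential_pdf// mule1.
- exact/measurable_EFinP.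
- by move=> x; rewrite lee_fin.
Qed.
End kernel.

Section wiener_integral.
Context {d : measure_display} {T : measurableType d} {R : realType}.
Variables (P : probability T R) (W : R -> {RV P >-> R}).
Hypothesis hW : standard_wiener W.
Notation mu := (@lebesgue_measure R).

Lemma measurable_step_eval (phi : step_fun R) : measurable_fun setT (step_eval phi).
Proof.
by apply: measurable_sum => i; exact: measurable_funM.
Qed.

Lemma measurable_step_integral (phi : step_fun R) :
  measurable_fun setT (step_integral W phi).
Proof.
apply: measurable_sum => i; apply: measurable_funM => //.
exact: measurable_funB.
Qed.

Lemma step_eval_sq_integrable (phi : step_fun R) :
  mu.-integrable setT (fun x => (step_eval phi x ^+ 2)%:E).
Proof.
have [t t_incr tk] :=
  increasing_grid [seq step_knot phi i | i <- iota 0 (step_size phi).+1].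
have g : on_grid t (size [seq step_knot phi i | i <- iota 0 (step_size phi).+1]) phi.
  by move=> i ip; apply: tk; apply/mapP; exists i => //; rewrite mem_iota.
exact: (integral_step_mul t_incr g g).1.
Qed.

(** The covariance is an equality because both sides are limits of the same numbers, by continuity
    of the inner product in L^2(P) and in L^2(R). The mixed fourth moment passes to the limit
    through Fatou's lemma. *)
Lemma wiener_integral_wick (f g : R -> R) (X Y : {RV P >-> R}) :
  measurable_fun setT f -> measurable_fun setT g ->
  is_wiener_integral W f X -> is_wiener_integral W g Y ->
  let C f g := \int[mu]_x (f x * g x) in
  [/\ P.-integrable setT (fun w => (X w ^+ 2)%:E),
      \int[P]_w (X w * Y w) = C f g &
      (\int[P]_w (X w ^+ 2 * Y w ^+ 2)%:E <=
        (C f f * C g g + 2 * C f g ^+ 2)%:E)%E].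
Proof.
move=> mf mg [phi [cphi cX]] [psi [cpsi cY]] C.
have me := measurable_step_eval; have ms := measurable_step_integral.
have Ie := step_eval_sq_integrable.
have Is a : P.-integrable setT (fun w => (step_integral W a w ^+ 2)%:E).
  by have [h _ _ _] := wiener_step_wick hW a a; exact: h.
have E2 a b : \int[P]_w (step_integral W a w * step_integral W b w) =
    \int[mu]_x (step_eval a x * step_eval b x).
  by have [_ h _ _] := wiener_step_wick hW a b; exact: h.
have cff := @L2_cvg_mul _ _ _ mu f f _ _ mf mf (fun n => me (phi n)) (fun n => me (phi n))
  (fun n => Ie (phi n)) (fun n => Ie (phi n)) cphi cphi.
have cfg := @L2_cvg_mul _ _ _ mu f g _ _ mf mg (fun n => me (phi n)) (fun n => me (psi n))
  (fun n => Ie (phi n)) (fun n => Ie (psi n)) cphi cpsi.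
have cgg := @L2_cvg_mul _ _ _ mu g g _ _ mg mg (fun n => me (psi n)) (fun n => me (psi n))
  (fun n => Ie (psi n)) (fun n => Ie (psi n)) cpsi cpsi.
have mX : measurable_fun setT X by [].
have mY : measurable_fun setT Y by [].
split.
- exact: L2_limit_sq_integrable mX (fun n => ms (phi n)) (fun n => Is (phi n)) cX.
- have := L2_cvg_mul mX mY (fun n => ms (phi n)) (fun n => ms (psi n))
    (fun n => Is (phi n)) (fun n => Is (psi n)) cX cY.
  under eq_cvg do rewrite E2.
  move=> h; apply: cvg_unique h cfg; exact: Rhausdorff.
- apply: (integral_sqr_mul_fatou mX mY (fun n => ms (phi n)) (fun n => ms (psi n)) cX cY).
  pose E n := \int[mu]_x (step_eval (phi n) x * step_eval (phi n) x) *
     \int[mu]_x (step_eval (psi n) x * step_eval (psi n) x) +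
     2 * (\int[mu]_x (step_eval (phi n) x * step_eval (psi n) x)) ^+ 2.
  have -> : (fun n => (\int[P]_w (step_integral W (phi n) w ^+ 2 *
      step_integral W (psi n) w ^+ 2)%:E)%E) = EFin \o E.
    apply/funext => n; have [_ _ h1 h2] := wiener_step_wick hW (phi n) (psi n).
    rewrite /= /E -h2 /Rintegral fineK//; exact: integrable_fin_num h1.
  apply/cvg_EFin; first exact: nearW.
  apply: cvgD; first exact: cvgM.
  by apply: cvgM; [exact: cvg_cst|exact: cvgM].
Qed.

Variables (theta : R) (xi : R -> {RV P >-> R}).
Hypotheses (theta0 : 0 < theta) (hxi : ornstein_uhlenbeck W theta xi).
Notation s2 := (2 * theta)^-1.

Lemma ou_sq_integrable t : P.-integrable setT (fun w => (xi t w ^+ 2)%:E).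
Proof.
have mk := measurable_ou_kernel theta t.
by have [h _ _] := wiener_integral_wick mk mk (ou_integral hxi t) (ou_integral hxi t).
Qed.

Lemma ou_variance t : \int[P]_w (xi t w ^+ 2) = s2.
Proof.
have mk := measurable_ou_kernel theta t.
have [_ h _] := wiener_integral_wick mk mk (ou_integral hxi t) (ou_integral hxi t).
rewrite -[LHS]/(\int[P]_w (xi t w * xi t w)) h integral_ou_kernel_mul//.
by rewrite subrr normr0 mulr0 expR0 mul1r.
Qed.

Lemma ou_sqr_mul_le s t : (\int[P]_w (xi t w ^+ 2 * xi s w ^+ 2)%:E <=
  (s2 ^+ 2 + 2 * s2 ^+ 2 * expR (- (2 * theta) * `|t - s|))%:E)%E.
Proof.
have [_ _ h] := wiener_integral_wick (measurable_ou_kernel theta t)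
  (measurable_ou_kernel theta s) (ou_integral hxi t) (ou_integral hxi s).
apply: (le_trans h); rewrite lee_fin !integral_ou_kernel_mul// !subrr normr0.
rewrite mulr0 expR0 !mul1r exprMn -expRM_natl -mulrA.
have -> : 2%:R * (- theta * `|t - s|) = - (2 * theta) * `|t - s| by ring.
by rewrite le_eqVlt; apply/orP; left; apply/eqP; ring.
Qed.

End wiener_integral.

(** * Time averages *)

Section riemann_sums.
Context {R : realType}.
Notation mu := (@lebesgue_measure R).

(** Dominated convergence for the step functions sampling [g] at left endpoints. The shift [N] makes
    every sum of the sequence, from k = 0 on, use more than [N] points, as the uniform variance
    bound will require. *)
Lemma cvg_riemann_sum (g : R -> R) (S : R) (N : nat) : 0 < S -> continuous g ->
  (k + N).+1%:R^-1 * \sum_(j < (k + N).+1) g (S * j%:R / (k + N).+1%:R)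
    @[k --> \oo] --> S^-1 * \int[mu]_(x in `[0, S]) g x.
Proof.
move=> S0 cg.
have mg : measurable_fun setT g by exact: continuous_measurable_fun.
have [M [M0 gM]] : exists M, 0 <= M /\ forall x, 0 <= x <= S -> `|g x| <= M.
  have := continuous_compact (continuous_subspaceT cg) (@segment_compact R 0 S).
  move=> /compact_bounded[M [_ /(_ (`|M| + 1))]].
  rewrite (le_lt_trans (ler_norm M)) ?ltrDl// => /(_ isT) gM.
  exists (`|M| + 1); split; first by rewrite addr_ge0.
  by move=> x x0S; apply: gM; exists x; rewrite //= in_itv.
pose K k := (k + N).+1.
have K0 k : 0 < (K k)%:R :> R by rewrite ltr0n.
pose t k j := S * j%:R / (K k)%:R.
have tS k j : t k j.+1 - t k j = S / (K k)%:R.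
  by rewrite /t -addn1 natrD; field; rewrite gt_eqF.
have tlt k j : t k j <= t k j.+1 by rewrite -subr_ge0 tS divr_ge0// ltW.
pose c k j (x : R) := \1_`]t k j, t k j.+1] x : R.
have c0 k j x : 0 <= c k j x by rewrite /c indicE.
(* The cells tile ]0, S], so [f k x] is a weighted mean of sampled values with total weight 1 there.
   This gives both the domination by [M] and the pointwise limit; the endpoint 0 is negligible for
   the integral. *)
have sumc k x : \sum_(j < K k) c k j x = \1_`]0, S] x.
  rewrite /c; under eq_bigr do rewrite indic_itvoc//.
  rewrite -(big_mkord xpredT (fun j => (x <= t k j.+1)%R%:R - (x <= t k j)%R%:R)).
  rewrite (telescope_sumr (fun j => (x <= t k j)%R%:R))// indic_itvoc; last exact: ltW.
  by rewrite /t mulr0 mul0r mulfK// gt_eqF.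
pose f k x := \sum_(j < K k) g (t k j) * c k j x.
have fE k : \int[mu]_x f k x = S * ((K k)%:R^-1 * \sum_(j < K k) g (t k j)).
  have [_ ->] := @Rintegral_lincomb _ _ _ mu (K k) (fun j => g (t k j))
    (fun j => \1_`]t k j, t k j.+1])
    (fun j _ => integrable_indic_itv (t k j) (t k j.+1) false false).
  rewrite mulrA mulr_sumr; apply: eq_bigr => j _; rewrite mulrC; congr (_ * _).
  rewrite /Rintegral integral_indic//= setIT lebesgue_measure_itv/= lte_fin.
  by rewrite -subr_gt0 tS divr_gt0// -EFinB tS.
pose G x := g x * \1_`]0, S] x.
have tin k j : (j < K k)%N -> 0 <= t k j <= S.
  move=> jK; apply/andP; split.
    by apply: divr_ge0; [apply: mulr_ge0 => //; exact: ltW|exact: ltW].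
  by rewrite /t ler_pdivrMr// ler_pM2l// ler_nat ltnW.
have fM k x : `|f k x| <= M * \1_`]0, S] x.
  rewrite -(sumc k) mulr_sumr; apply: le_trans (ler_norm_sum _ _ _) _.
  by apply: ler_sum => j _; rewrite normrM (ger0_norm (c0 _ _ _)) ler_wpM2r// gM// tin.
have fG x : f k x @[k --> \oo] --> G x.
  apply/cvgrPdist_le => e e0.
  have /cvgrPdist_le/(_ _ e0)/nbhs_ballP[r /= r0 gr] := cg x.
  have cN : S / (K k)%:R @[k --> \oo] --> 0.
    rewrite -[X in _ --> X](mulr0 S); apply: cvgM; first exact: cvg_cst.
    rewrite (_ : (fun k => _) = (fun k => harmonic (k + N)%N)) //.
    by rewrite (cvg_shiftn N (harmonic : nat -> R)); exact: cvg_harmonic.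
  have /cvgrPdist_lt/(_ _ r0) := cN; apply: filterS => k.
  rewrite sub0r normrN gtr0_norm ?divr_gt0// => Sr.
  have -> : G x - f k x = \sum_(j < K k) (g x - g (t k j)) * c k j x.
    by under eq_bigr do rewrite mulrBl; rewrite sumrB -mulr_sumr sumc.
  apply: le_trans (ler_norm_sum _ _ _) _.
  apply: (@le_trans _ _ (\sum_(j < K k) e * c k j x)).
    apply: ler_sum => j _; rewrite normrM (ger0_norm (c0 _ _ _)).
    rewrite /c indicE mem_setE in_itv/=.
    have [/andP[tx xt]|_] := boolP (_ && _); last by rewrite !mulr0.
    rewrite !mulr1; apply: gr; rewrite /ball/= gtr0_norm ?subr_gt0//.
    by rewrite (le_lt_trans _ Sr)// -(tS k j) lerD2r.
  rewrite -mulr_sumr sumc indicE; case: (_ \in _) => /=; rewrite ?mulr1// mulr0.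
  exact: ltW.
have mf k : measurable_fun setT (f k).
  by apply: measurable_sum => j; apply: measurable_funM => //; exact: measurable_indic.
have iM : mu.-integrable setT (fun x => (M * \1_`]0, S] x)%:E).
  exact: (integrableZl measurableT M (integrable_indic_itv 0 S false false)).
have mG : measurable_fun setT G by apply: measurable_funM => //; exact: measurable_indic.
have mEf k : measurable_fun setT (EFin \o f k) by exact/measurable_EFinP.
have mEG : measurable_fun setT (EFin \o G) by exact/measurable_EFinP.
have aeG : {ae mu, forall x, setT x -> (EFin \o f k) x @[k --> \oo] --> (EFin \o G) x}.
  by apply: aeW => x _; apply/cvg_EFin; [exact: nearW|exact: fG].
have aeM : {ae mu, forall x k, setT x ->
    (`|(EFin \o f k) x| <= (M * \1_`]0, S] x)%:E)%E}.
  by apply: aeW => x k _; rewrite lee_fin.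
have [iG _ cvgf] := @dominated_convergence _ _ _ mu setT measurableT _ _ _ mEf mEG aeG iM aeM.
have {}cvgf : \int[mu]_x f k x @[k --> \oo] --> \int[mu]_x G x.
  apply: fine_cvg; rewrite /Rintegral fineK; last exact: integrable_fin_num.
  exact: cvgf.
have GE : \int[mu]_x G x = \int[mu]_(x in `[0, S]) g x.
  rewrite -(@Rintegral_itv_obnd_cbnd _ 0); last first.
    apply: (@integrableS _ _ _ mu `[0, S]%classic) => //.
      exact: subset_itv_oc_cc.
    apply: continuous_compact_integrable; first exact: segment_compact.
    exact: continuous_subspaceT.
  rewrite [RHS]Rintegral_mkcond; apply: eq_Rintegral => x _.
  by rewrite /G patchE indicE; case: (_ \in _); rewrite ?mulr1// mulr0.
rewrite -GE (_ : (fun k => _) = (fun k => S^-1 * \int[mu]_x f k x)).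
  by apply: cvgM => //; exact: cvg_cst.
by apply/funext => k; rewrite fE mulKf// gt_eqF.
Qed.
End riemann_sums.

Section correlated_sums.
Context {d : measure_display} {T : measurableType d} {R : realType}.
Variable P : probability T R.

Lemma sum_expr_rev_le (q : R) K : 0 <= q -> q < 1 ->
  \sum_(j < K) q ^+ (K - j) <= q / (1 - q).
Proof.
move=> q0 q1; have q1' : 0 < 1 - q by rewrite subr_gt0.
elim: K => [|K IH]; first by rewrite big_ord0 divr_ge0// ltW.
rewrite big_ord_recr/= subSnn expr1.
have -> : \sum_(j < K) q ^+ (K.+1 - j) = q * \sum_(j < K) q ^+ (K - j).
  by rewrite mulr_sumr; apply: eq_bigr => j _; rewrite subSn ?exprS// ltnW.
apply: (@le_trans _ _ (q * (q / (1 - q)) + q)); first by rewrite lerD2r ler_wpM2l.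
by rewrite le_eqVlt; apply/orP; left; apply/eqP; field; rewrite gt_eqF.
Qed.

(** Induction on [K]: a new term adds at most b from its own variance and 2 b q / (1 - q) from twice
    its covariances with the past, a geometric series. Together they stay below 2 b / (1 - q). *)
Lemma correlated_sum_le (A : nat -> T -> R) (m b q : R) :
  0 <= q -> q < 1 -> 0 <= b ->
  (forall i, P.-integrable setT (fun w => (A i w)%:E)) ->
  (forall i j, P.-integrable setT (fun w => (A i w * A j w)%:E)) ->
  (forall i, \int[P]_w A i w = m) ->
  (forall i j, (i <= j)%N -> \int[P]_w (A i w * A j w) <= m ^+ 2 + b * q ^+ (j - i)) ->
  forall K,
    P.-integrable setT (fun w => ((\sum_(j < K) (A j w - m)) ^+ 2)%:E) /\
    \int[P]_w ((\sum_(j < K) (A j w - m)) ^+ 2) <= K%:R * (2 * b / (1 - q)).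
Proof.
move=> q0 q1 b0 IA IAA EA EAA.
have q1' : 0 < 1 - q by rewrite subr_gt0.
have I1 : P.-integrable setT (fun w => (1 : R)%:E).
  exact: finite_measure_integrable_cst.
have E1 : \int[P]_w (1 : R) = 1.
  by rewrite Rintegral_cst// mul1r; apply: (congr1 fine (probability_setT P)).
have Z i j : P.-integrable setT (fun w => ((A i w - m) * (A j w - m))%:E) /\
    \int[P]_w ((A i w - m) * (A j w - m)) = \int[P]_w (A i w * A j w) - m ^+ 2.
  have [h1 h2] := @Rintegral_lincomb _ _ _ P 4 (nth 0 [:: 1; - m; - m; m ^+ 2])
    (nth (fun=> 0) [:: (fun w => A i w * A j w); A i; A j; (fun=> 1)])
    (fun i i4 => ltac:(move: i i4 => [|[|[|[|//]]]] _;
      [exact: IAA|exact: IA|exact: IA|exact: I1])).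
  have E w : \sum_(k < 4) nth 0 [:: 1; - m; - m; m ^+ 2] k *
    nth (fun=> 0) [:: (fun w => A i w * A j w); A i; A j; (fun=> 1)] k w =
    (A i w - m) * (A j w - m).
    by rewrite !big_ord_recl big_ord0/=; ring.
  split; first by apply: eqfun_integrable h1 _ => w; rewrite E.
  under eq_Rintegral do rewrite -E.
  by rewrite h2 !big_ord_recl big_ord0/= !EA E1; ring.
elim=> [|K [IK EK]].
  have E w : (\sum_(j < 0) (A j w - m)) ^+ 2 = 0 by rewrite big_ord0 expr0n.
  split; first by apply: eqfun_integrable (integrable0 P setT) _ => w; rewrite E.
  by under eq_Rintegral do rewrite E; rewrite Rintegral_cst// !mul0r.
have [c1 c2] := @Rintegral_lincomb _ _ _ P K (fun=> 1)
  (fun j w => (A j w - m) * (A K w - m)) (fun j _ => (Z j K).1).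
have [h1 h2] := @Rintegral_lincomb _ _ _ P 3 (nth 0 [:: 1; 2; 1])
  (nth (fun=> 0) [:: (fun w => (\sum_(j < K) (A j w - m)) ^+ 2);
     (fun w => \sum_(j < K) 1 * ((A j w - m) * (A K w - m)));
     (fun w => (A K w - m) * (A K w - m))])
  (fun i i3 => ltac:(move: i i3 => [|[|[|//]]] _;
      [exact: IK|exact: c1|exact: (Z K K).1])).
have E w : \sum_(i < 3) nth 0 [:: 1; 2; 1] i *
  nth (fun=> 0) [:: (fun w => (\sum_(j < K) (A j w - m)) ^+ 2);
     (fun w => \sum_(j < K) 1 * ((A j w - m) * (A K w - m)));
     (fun w => (A K w - m) * (A K w - m))] i w =
    (\sum_(j < K.+1) (A j w - m)) ^+ 2.
  rewrite [in RHS]big_ord_recr !big_ord_recl big_ord0/=.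
  by under [X in _ + (2 * X + _)]eq_bigr do rewrite mul1r; rewrite -mulr_suml; ring.
split; first by apply: eqfun_integrable h1 _ => w; rewrite E.
under eq_Rintegral do rewrite -E.
rewrite h2 !big_ord_recl big_ord0/= c2 addr0 !mul1r (Z K K).2.
under eq_bigr do rewrite mul1r (Z _ _).2.
have ZK : \int[P]_w (A K w * A K w) - m ^+ 2 <= b.
  by rewrite lerBlDl (le_trans (EAA K K (leqnn K)))// subnn expr0 mulr1.
have Zs : \sum_(j < K) (\int[P]_w (A j w * A K w) - m ^+ 2) <= b * (q / (1 - q)).
  apply: (@le_trans _ _ (\sum_(j < K) b * q ^+ (K - j))).
    by apply: ler_sum => j _; rewrite lerBlDl EAA// ltnW.
  by rewrite -mulr_sumr ler_wpM2l// sum_expr_rev_le.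
have -> : K.+1%:R = K%:R + 1 :> R by rewrite natr1.
rewrite [leRHS]mulrDl mul1r lerD//.
apply: (@le_trans _ _ (2 * (b * (q / (1 - q))) + b)).
  by rewrite lerD// ler_wpM2l.
have -> : 2 * b / (1 - q) = 2 * (b * (q / (1 - q))) + 2 * b.
  by field; rewrite gt_eqF.
by rewrite lerD2l ler_peMl// ler1n.
Qed.

Variables (W : R -> {RV P >-> R}) (theta : R) (xi : R -> {RV P >-> R}).
Hypotheses (hW : standard_wiener W) (theta0 : 0 < theta).
Hypothesis hxi : ornstein_uhlenbeck W theta xi.
Notation s2 := (2 * theta)^-1.

Lemma ou_sqr_mul_integrable s t :
  P.-integrable setT (fun w => (xi s w ^+ 2 * xi t w ^+ 2)%:E).
Proof.
apply/integrableP; split.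
  by apply/measurable_EFinP/measurable_funM; exact: measurable_funX.
rewrite (eq_integral (fun w => (xi s w ^+ 2 * xi t w ^+ 2)%:E)).
  exact: le_lt_trans (ou_sqr_mul_le hW theta0 hxi t s) (ltry _).
by move=> w _; rewrite gee0_abs// lee_fin mulr_ge0 ?sqr_ge0.
Qed.

(** The sampled covariances decay geometrically with ratio q = exp (- x), x = 2 theta S / K, and b =
    2 s2^2. Since 1 - q >= x / 2, the variance is at most 2 b / (K x / 2) = 8 s2^3 / S, where [K]
    has disappeared. *)
Lemma ou_average_variance (S : R) (K : nat) : 0 < S ->
  2 * theta * S <= K%:R ->
  (\int[P]_w ((K%:R^-1 * (\sum_(j < K) xi (S * j%:R / K%:R) w ^+ 2) - s2) ^+ 2)%:E <=
    (8 * s2 ^+ 3 / S)%:E)%E.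
Proof.
move=> S0 SK; have t20 : 0 < 2 * theta by rewrite mulr_gt0.
have Kr : 0 < K%:R :> R by rewrite (lt_le_trans _ SK)// mulr_gt0.
pose x := 2 * theta * S / K%:R.
have x0 : 0 < x by rewrite divr_gt0// mulr_gt0.
have x1 : x <= 1 by rewrite ler_pdivrMr// mul1r.
pose q := expR (- x).
have q0 : 0 <= q by exact: expR_ge0.
have q1 : q < 1 by rewrite -expR0 ltr_expR oppr_lt0.
have q1' : 0 < 1 - q by rewrite subr_gt0.
(* From exp x >= 1 + x one gets 1 - q >= x / (1 + x), and x <= 1, ensured by the lower bound on [K],
   makes this at least x / 2. *)
have xq : x / 2 <= 1 - q.
  have h : q * (1 + x) <= 1.
    have qx : q * expR x = 1 by rewrite /q -expRD addNr expR0.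
    by rewrite -[leRHS]qx ler_wpM2l// expR_ge1Dx.
  have x1' : 0 < 1 + x by rewrite addr_gt0.
  rewrite -subr_ge0 -(pmulr_lge0 _ x1').
  have -> : (1 - q - x / 2) * (1 + x) = (1 - q * (1 + x)) + x * (1 - x) / 2.
    by field.
  rewrite addr_ge0 ?subr_ge0// divr_ge0// mulr_ge0 ?subr_ge0//; exact: ltW.
have b0 : 0 <= 2 * s2 ^+ 2 by rewrite mulr_ge0 ?sqr_ge0.
have b20 : 0 <= 2 * (2 * s2 ^+ 2) by rewrite mulr_ge0.
pose A j w := xi (S * j%:R / K%:R) w ^+ 2.
have [||h1 h2] := @correlated_sum_le A s2 (2 * s2 ^+ 2) q q0 q1 _
   (fun i => ou_sq_integrable hW hxi _) (fun i j => ou_sqr_mul_integrable _ _)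
   (fun i => ou_variance hW theta0 hxi _) _ K.
- exact: b0.
- move=> i j ij; rewrite /Rintegral -lee_fin fineK; last first.
    exact: integrable_fin_num (ou_sqr_mul_integrable _ _).
  apply: (le_trans (ou_sqr_mul_le hW theta0 hxi _ _)).
  rewrite lee_fin lerD2l ler_wpM2l//.
  rewrite -expRM_natl ler_expR.
  have -> : S * i%:R / K%:R - S * j%:R / K%:R = - ((j - i)%:R * (S / K%:R)).
    by rewrite natrB//; field; rewrite gt_eqF.
  have d0 : 0 <= (j - i)%:R * (S / K%:R).
    by apply: mulr_ge0 => //; apply: divr_ge0; exact: ltW.
  rewrite normrN (ger0_norm d0).
  by rewrite le_eqVlt; apply/orP; left; apply/eqP; rewrite /x; ring.
pose D := fun w => (K%:R^-1 * (\sum_(j < K) A j w) - s2) ^+ 2.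
have DE w : D w = K%:R^-2 * (\sum_(j < K) (A j w - s2)) ^+ 2.
  rewrite sumrB sumr_const card_ord /D -exprVn -exprMn; congr (_ ^+ 2).
  by rewrite mulrBr -[s2 *+ K]mulr_natl mulKf ?gt_eqF.
rewrite (eq_integral (fun w => (K%:R^-2)%:E *
    ((\sum_(j < K) (A j w - s2)) ^+ 2)%:E)%E); last first.
  by move=> w _; rewrite -EFinM -DE.
rewrite integralZl//.
have -> : (\int[P]_w ((\sum_(j < K) (A j w - s2)) ^+ 2)%:E)%E =
    (\int[P]_w ((\sum_(j < K) (A j w - s2)) ^+ 2))%:E.
  by rewrite /Rintegral fineK//; exact: integrable_fin_num h1.
rewrite -EFinM lee_fin.
apply: (@le_trans _ _ (K%:R^-2 * (K%:R * (2 * (2 * s2 ^+ 2) / (1 - q))))).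
  by rewrite ler_wpM2l// invr_ge0 sqr_ge0.
apply: (@le_trans _ _ (K%:R^-2 * (K%:R * (2 * (2 * s2 ^+ 2) / (x / 2))))).
  rewrite ler_wpM2l ?invr_ge0 ?sqr_ge0// ler_wpM2l//.
  by rewrite ler_wpM2l// lef_pV2 ?posrE// divr_gt0.
rewrite le_eqVlt; apply/orP; left; apply/eqP; rewrite /x.
by field; rewrite !gt_eqF.
Qed.
End correlated_sums.

Lemma sum_inv_sqr_le {R : realType} n : \sum_(k < n) (k.+1%:R ^+ 2)^-1 <= 2 :> R.
Proof.
case: n => [|n]; first by rewrite big_ord0.
(* The induction needs the sharper bound 2 - 1 / (n + 1), whose increments dominate the inverse
   squares. *)
suff : \sum_(k < n.+1) (k.+1%:R ^+ 2)^-1 <= 2 - n.+1%:R^-1 :> R.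
  by move=> /le_trans; apply; rewrite gerBl.
elim: n => [|n IH]; first by rewrite big_ord1 expr1n invr1; lra.
rewrite big_ord_recr/=; apply: le_trans (lerD IH (lexx _)) _.
have n1 : 0 < n.+1%:R :> R by [].
have -> : n.+2%:R = n.+1%:R + 1 :> R by rewrite natr1.
move: (n.+1%:R) n1 => x x0.
have x1 : 0 < x + 1 by rewrite addr_gt0.
rewrite -subr_ge0.
have -> : 2 - (x + 1)^-1 - (2 - x^-1 + ((x + 1) ^+ 2)^-1) =
    (x * (x + 1) ^+ 2)^-1 by field; rewrite !gt_eqF.
by rewrite invr_ge0 mulr_ge0 ?sqr_ge0 ?ltW.
Qed.

Lemma limn_einf_le {R : realType} (u : nat -> \bar R) (c : \bar R) :
  (forall n, u n <= c)%E -> (limn_einf u <= c)%E.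
Proof.
move=> uc; rewrite limn_einf_lim; apply: lime_le; first exact: is_cvg_einfs.
apply: nearW => n; apply: le_trans (uc n).
by apply: ereal_inf_lbound; exists n => /=.
Qed.

Section ergodicity.
Context {d : measure_display} {T : measurableType d} {R : realType}.
Variables (P : probability T R) (W : R -> {RV P >-> R}) (theta h : R).
Variable xi : R -> {RV P >-> R}.
Hypotheses (hW : standard_wiener W) (theta0 : 0 < theta) (h0 : 0 < h).
Hypothesis hxi : ornstein_uhlenbeck W theta xi.
Notation s2 := (2 * theta)^-1.
Notation mu := (@lebesgue_measure R).

(* Fatou's lemma is applied to the Riemann sums of the continuous paths, which
   spares a joint measurability argument for [xi] and Fubini's theorem. *)
Lemma ou_time_average_ae :
  {ae P, forall w, ((m.+1 ^ 2)%:R * h)^-1 *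
    \int[mu]_(t in `[0, (m.+1 ^ 2)%:R * h]) (xi t w ^+ 2) @[m --> \oo] --> s2}.
Proof.
pose S m := (m.+1 ^ 2)%:R * h.
have S0 m : 0 < S m by rewrite mulr_gt0// ltr0n expn_gt0.
(* Chosen so that all Riemann sums on [0, S m] have enough points for the variance bound; it then
   holds for every [k], and so for the lower limit. *)
pose N m := Num.bound (2 * theta * S m).
have SN m : 2 * theta * S m <= (N m)%:R.
  by apply/ltW/archi_boundP; apply: mulr_ge0; [apply: mulr_ge0|]; exact: ltW.
pose A m k w := (k + N m).+1%:R^-1 *
  \sum_(j < (k + N m).+1) xi (S m * j%:R / (k + N m).+1%:R) w ^+ 2.
pose H m k w := ((A m k w - s2) ^+ 2)%:E.
have mH m k : measurable_fun setT (H m k).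
  apply/measurable_EFinP/measurable_funX/measurable_funB => //.
  apply: measurable_funM => //; apply: measurable_sum => j.
  exact: measurable_funX.
have H0 m k w : (0 <= H m k w)%E by rewrite lee_fin sqr_ge0.
pose L m w := limn_einf (H m ^~ w).
have L0 m w : (0 <= L m w)%E by apply: limn_einf_ge0 => k; exact: H0.
have mL m : measurable_fun setT (L m) by exact: measurable_fun_limn_einf.
have IL m : (\int[P]_w L m w <= (8 * s2 ^+ 3 / S m)%:E)%E.
  apply: (le_trans (fatou P measurableT (mH m) (fun k w _ => H0 m k w))).
  apply: limn_einf_le => k; apply: (ou_average_variance hW theta0 hxi) => //.
  by rewrite (le_trans (SN m))// ler_nat (leq_trans (leq_addl k _)).
(* [L m w] is an extended real, so [fine] truncates infinite values to 0. On a continuous path it is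
   the finite number [(Y m - s2) ^+ 2], as [LE] shows, and nothing is lost. *)
have aeF : {ae P, forall w, fine (L m w) @[m --> \oo] --> 0}.
  apply: (@ae_cvg0_summable _ _ _ P (fun m w => fine (L m w))
    (fun m => 8 * s2 ^+ 3 / S m) (8 * s2 ^+ 3 / h * 2)).
  - by move=> m; exact: measurableT_comp.
  - by move=> m w; exact: fine_ge0.
  - move=> m; apply: le_trans (IL m); apply: ge0_le_integral => //.
    + by move=> w _; rewrite lee_fin fine_ge0.
    + by apply/measurable_EFinP; exact: measurableT_comp.
    + move=> w _; case: (L m w) (L0 m w) => [r| |]//= _; exact: leey.
  - move=> n; rewrite (_ : \sum_(k < n) _ =
        8 * s2 ^+ 3 / h * \sum_(k < n) (k.+1%:R ^+ 2)^-1); last first.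
      rewrite mulr_sumr; apply: eq_bigr => k _.
      rewrite /S natrX; move: (8 * _) => c.
      by rewrite invfM mulrA mulrAC.
    rewrite ler_wpM2l ?sum_inv_sqr_le//; apply: divr_ge0; last exact: ltW.
    by apply: mulr_ge0 => //; apply: exprn_ge0; rewrite invr_ge0 mulr_ge0// ltW.
apply: filterS2 aeF (ou_continuous hxi) => w Fw cw.
pose Y m := (S m)^-1 * \int[mu]_(t in `[0, S m]) (xi t w ^+ 2).
have LE m : L m w = ((Y m - s2) ^+ 2)%:E.
  apply: (cvg_limn_einf_sup _).1.
  have cA : A m k w @[k --> \oo] --> Y m.
    apply: (@cvg_riemann_sum _ (fun t => xi t w ^+ 2)) => // t.
    by apply: (@continuousM _ _ (fun t => xi t w) (fun t => xi t w)); exact: cw.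
  apply/cvg_EFin; first exact: nearW.
  apply: cvgM; by apply: cvgB => //; exact: cvg_cst.
have {}Fw : (Y m - s2) ^+ 2 @[m --> \oo] --> 0.
  by under eq_cvg do rewrite -[(Y _ - _) ^+ 2]/(fine ((Y _ - s2) ^+ 2)%:E) -LE.
exact: cvg_sqr_dist.
Qed.

(** The square of the ratio has expectation at most 3 s2^2 / (n + 1)^2, by the mixed moment bound at
    equal times. The denominator [n.+1] keeps the bound meaningful at n = 0. *)
Lemma ou_endpoint_ae :
  {ae P, forall w, xi (n%:R * h) w ^+ 2 / n.+1%:R @[n --> \oo] --> 0}.
Proof.
pose F n w := (xi (n%:R * h) w ^+ 2 / n.+1%:R) ^+ 2.
have : {ae P, forall w, F n w @[n --> \oo] --> 0}.
  apply: (@ae_cvg0_summable _ _ _ P F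
    (fun n => 3 * s2 ^+ 2 * (n.+1%:R ^+ 2)^-1) (3 * s2 ^+ 2 * 2)).
  - move=> n; apply: measurable_funX; apply: measurable_funM => //.
    exact: measurable_funX.
  - by move=> n w; exact: sqr_ge0.
  - move=> n; under eq_integral do rewrite /F exprMn exprVn mulrC EFinM.
    rewrite ge0_integralZl//; last 2 first.
    - by apply/measurable_EFinP; do 2 apply: measurable_funX.
    - by move=> w _; rewrite lee_fin sqr_ge0.
    rewrite [X in (_ <= X%:E)%E]mulrC EFinM lee_wpmul2l//.
    have := ou_sqr_mul_le hW theta0 hxi (n%:R * h) (n%:R * h).
    rewrite subrr normr0 mulr0 expR0 mulr1.
    rewrite (_ : s2 ^+ 2 + 2 * s2 ^+ 2 = 3 * s2 ^+ 2)//; by ring.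
  - by move=> n; rewrite -mulr_sumr ler_wpM2l ?sum_inv_sqr_le// mulr_ge0 ?sqr_ge0.
apply: filterS => w Fw; apply: cvg_sqr_dist.
by under eq_cvg do rewrite subr0.
Qed.
End ergodicity.

(** * Consistency of the estimator *)

Section estimator.
Context {R : realType}.
Notation mu := (@lebesgue_measure R).

Lemma cvg_ratio_succ : (n%:R / n.+1%:R : R) @[n --> \oo] --> (1 : R).
Proof.
rewrite -[X in _ --> X]subr0.
have -> : (fun n => n%:R / n.+1%:R : R) = (fun n => 1 - harmonic n).
  apply/funext => n; rewrite /harmonic/= -natr1; field.
  by rewrite natr1 pnatr_eq0.
by apply: cvgB; [exact: cvg_cst|exact: cvg_harmonic].
Qed.

Lemma cvg_succ_ratio : (n.+1%:R / n%:R : R) @[n --> \oo] --> (1 : R).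
Proof.
rewrite -[X in _ --> X]invr1.
have -> : (fun n => n.+1%:R / n%:R : R) = (fun n => (n%:R / n.+1%:R)^-1).
  by apply/funext => n; rewrite invf_div.
by apply: cvgV; [exact: oner_neq0|exact: cvg_ratio_succ].
Qed.

Lemma exists_sqrtn : exists s : nat -> nat,
  forall n, ((s n) ^ 2 <= n < (s n).+1 ^ 2)%N.
Proof.
suff [s sP] : {s : nat -> nat & forall n, ((s n) ^ 2 <= n < (s n).+1 ^ 2)%N}.
  by exists s.
apply: (@choice _ _ (fun n m => (m ^ 2 <= n < m.+1 ^ 2)%N)).
elim=> [|n [m /andP[mn nm]]]; first by exists 0%N.
have [nm'|nm'] := ltnP n.+1 (m.+1 ^ 2).
  by exists m; rewrite nm' andbT (leq_trans mn).
by exists m.+1; rewrite nm'/= (leq_trans (n := (m.+1 ^ 2).+1))// ltn_exp2r.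
Qed.

(** If s^2 <= n < (s + 1)^2, monotonicity gives u(s^2) / (s + 1)^2 <= u(n) / n <= u((s + 1)^2) /
    s^2. Both bounds tend to [c], since consecutive squares have ratio tending to 1. *)
Lemma cvg_ratio_from_squares (u : nat -> R) (c : R) :
  nondecreasing_seq u -> (forall n, 0 <= u n) ->
  u (m.+1 ^ 2)%N / (m.+1 ^ 2)%:R @[m --> \oo] --> c ->
  u n / n%:R @[n --> \oo] --> c.
Proof.
move=> uinc u0 uc; have [s sP] := exists_sqrtn.
have s_oo : s n @[n --> \oo] --> \oo.
  apply/cvgnyPge => N; near=> n; rewrite -ltnS -(@ltn_exp2r _ _ 2)//.
  have /andP[_] := sP n; apply: leq_ltn_trans.
  by near: n; exact: nbhs_infty_ge.
have pred_oo : m.-1 @[m --> \oo] --> \oo.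
  apply/cvgnyPge => N; near=> m; rewrite -ltnS prednK; last first.
    by near: m; exact: nbhs_infty_gt.
  by near: m; exact: nbhs_infty_gt.
pose v m := u (m.+1 ^ 2)%N / (m.+1 ^ 2)%:R.
(* [v] is indexed from the square 1, so [v m.-1] is the ratio at m^2 for positive [m]. *)
pose a m := v m.-1 * (m%:R / m.+1%:R) ^+ 2.
pose b m := v m * (m.+1%:R / m%:R) ^+ 2.
have ac : a m @[m --> \oo] --> c.
  rewrite -[X in _ --> X]mulr1 -[X in _ * X](expr1n _ 2).
  apply: cvgM; first exact: (cvg_comp _ _ pred_oo uc).
  by apply: cvgM; exact: cvg_ratio_succ.
have bc : b m @[m --> \oo] --> c.
  rewrite -[X in _ --> X]mulr1 -[X in _ * X](expr1n _ 2).
  by apply: cvgM; [exact: uc|apply: cvgM; exact: cvg_succ_ratio].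
apply: (squeeze_cvgr _ (cvg_comp _ _ s_oo ac) (cvg_comp _ _ s_oo bc)).
near=> n => /=.
have n0 : (0 < n)%N by near: n; exact: nbhs_infty_gt.
have /andP[sn ns] := sP n.
have s0 : (0 < s n)%N.
  by case: (s n) ns => //; rewrite exp1n ltnS leqNgt n0.
have nr : 0 < n%:R :> R by rewrite ltr0n.
have sr : 0 < (s n)%:R :> R by rewrite ltr0n.
have sr1 : 0 < (s n).+1%:R :> R by rewrite ltr0n.
apply/andP; split.
  rewrite /a /v prednK//.
  have -> : u (s n ^ 2)%N / (s n ^ 2)%:R * ((s n)%:R / (s n).+1%:R) ^+ 2 =
      u (s n ^ 2)%N / (s n).+1%:R ^+ 2.
    by rewrite natrX; field; rewrite !gt_eqF.
  apply: ler_pM; [exact: u0|by rewrite invr_ge0 sqr_ge0|exact: uinc|].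
  by rewrite lef_pV2 ?posrE ?exprn_gt0// -natrX ler_nat ltnW.
rewrite /b /v.
have -> : u ((s n).+1 ^ 2)%N / ((s n).+1 ^ 2)%:R * ((s n).+1%:R / (s n)%:R) ^+ 2 =
    u ((s n).+1 ^ 2)%N / (s n)%:R ^+ 2.
  by rewrite natrX; field; rewrite !gt_eqF.
apply: ler_pM; [exact: u0|by rewrite invr_ge0|by apply: uinc; exact: ltnW|].
by rewrite lef_pV2 ?posrE ?exprn_gt0// -natrX ler_nat.
Unshelve. all: by end_near.
Qed.

Lemma cvg_mle (x : R -> R) (theta h : R) : 0 < theta -> 0 < h -> continuous x ->
  x (n%:R * h) ^+ 2 / n.+1%:R @[n --> \oo] --> 0 ->
  ((m.+1 ^ 2)%:R * h)^-1 * \int[mu]_(t in `[0, (m.+1 ^ 2)%:R * h]) (x t ^+ 2)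
    @[m --> \oo] --> (2 * theta)^-1 ->
  mle x (n%:R * h) @[n --> \oo] --> theta.
Proof.
move=> theta0 h0 cx cend cavg.
have hn0 : h != 0 by rewrite gt_eqF.
pose u n := \int[mu]_(t in `[0, n%:R * h]) (x t ^+ 2).
have cx2 : continuous (fun t => x t ^+ 2).
  by move=> t; apply: (@continuousM _ _ x x); exact: cx.
have Ix n : mu.-integrable `[0, n%:R * h] (fun t => (x t ^+ 2)%:E).
  apply: continuous_compact_integrable; first exact: segment_compact.
  exact: continuous_subspaceT.
have u0 n : 0 <= u n by apply: Rintegral_ge0 => t _; exact: sqr_ge0.
have uinc : nondecreasing_seq u.
  move=> m n mn; apply: fine_le; [exact: integrable_fin_num (Ix m)
    |exact: integrable_fin_num (Ix n)|].
  apply: ge0_subset_integral => //.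
  - exact: measurable_int (Ix n).
  - by move=> t _; rewrite lee_fin sqr_ge0.
  - by apply: subset_itvl; rewrite bnd_simp ler_wpM2r ?ler_nat// ltW.
have uc : u n / n%:R @[n --> \oo] --> h * (2 * theta)^-1.
  apply: (cvg_ratio_from_squares uinc u0).
  have -> : (fun m => u (m.+1 ^ 2)%N / (m.+1 ^ 2)%:R) =
      (fun m => h * (((m.+1 ^ 2)%:R * h)^-1 * u (m.+1 ^ 2)%N)).
    by apply/funext => m; rewrite invfM mulrA mulrCA mulfV// mulr1 mulrC.
  by apply: cvgM => //; exact: cvg_cst.
have endc : x (n%:R * h) ^+ 2 / n%:R @[n --> \oo] --> 0.
  rewrite -(mul0r (1 : R)).
  apply: cvg_trans _ (cvgM cend cvg_succ_ratio); apply: near_eq_cvg; near=> n.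
  by rewrite /= mulrA divfK// pnatr_eq0.
have invc : n%:R^-1 @[n --> \oo] --> (0 : R).
  rewrite -(mul0r (1 : R)).
  apply: cvg_trans _ (cvgM (@cvg_harmonic R) cvg_succ_ratio).
  apply: near_eq_cvg; near=> n.
  by rewrite /= /harmonic/= mulrA mulVf ?div1r// pnatr_eq0.
(* The estimator as a rational expression in three sequences with known limits. The identity
   includes n = 0, where both sides use the inverse of 0 as 0. *)
have -> : (fun n => mle x (n%:R * h)) = (fun n =>
    (1 + x 0 ^+ 2 / h * n%:R^-1 - h^-1 * (x (n%:R * h) ^+ 2 / n%:R)) /
    (2 / h * (u n / n%:R))).
  apply/funext => n; rewrite /mle -/(u n) !(invfM n%:R h).
  by congr (_ / _); ring.
have theta_lim : theta = (1 + x 0 ^+ 2 / h * 0 - h^-1 * 0) / (2 / h * (h * (2 * theta)^-1)).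
  by field; rewrite hn0 gt_eqF.
rewrite [X in _ --> X]theta_lim.
apply: cvgM.
  apply: cvgB; last by apply: cvgM => //; exact: cvg_cst.
  apply: cvgD; first exact: cvg_cst.
  by apply: cvgM => //; exact: cvg_cst.
apply: cvgV; first by rewrite !mulf_neq0// ?invr_eq0 ?mulf_neq0// gt_eqF.
by apply: cvgM => //; exact: cvg_cst.
Unshelve. all: by end_near.
Qed.

(** For a <= b the difference is exp (- a) (1 - exp (a - b)), with first factor at most 1 and second
    at most b - a by 1 + u <= exp u. *)
Lemma ler_dist_expRN (a b : R) : 0 <= a -> 0 <= b ->
  `|expR (- a) - expR (- b)| <= `|a - b|.
Proof.
wlog ab : a b / a <= b.
  move=> H a0 b0; have [ab|/ltW ba] := leP a b; first exact: H.
  by rewrite distrC [leRHS]distrC H.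
move=> a0 b0; rewrite ger0_norm; last by rewrite subr_ge0 ler_expR lerN2.
rewrite distrC ger0_norm ?subr_ge0//.
have -> : - b = - a + (a - b) by ring.
rewrite expRD -{1}[expR (- a)]mulr1 -mulrBr.
have e1 : expR (- a) <= 1 by rewrite -expR0 ler_expR oppr_le0.
have e2 := expR_ge1Dx (a - b).
have e3 : 0 <= 1 - expR (a - b) by rewrite subr_ge0 -expR0 ler_expR subr_le0.
apply: le_trans (ler_wpM2r e3 e1) _; lra.
Qed.

Lemma norm_rhoB_le (h : R) (h0 : 0 < h) (a b : R) : 0 <= a -> 0 <= b ->
  `|rho h0 a - rho h0 b| <= `|a - b| * h.
Proof.
move=> a0 b0; apply: op_norm_le => x x1.
apply: range_sup_le => [|t]; first by rewrite mulr_ge0// ltW.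
rewrite -[X in `|X|]/(expR (- a * \val t) * x (SigSub (rho_endpoint h0)) -
  expR (- b * \val t) * x (SigSub (rho_endpoint h0))).
have := set_valP t; rewrite /= in_itv /= => /andP[t0 th].
rewrite -mulrBl normrM -[leRHS]mulr1; apply: ler_pM => //; last first.
  exact: le_trans (C0_norm_ge _ _) x1.
rewrite !mulNr; apply: le_trans (ler_dist_expRN _ _) _; rewrite ?mulr_ge0//.
by rewrite -mulrBl normrM (ger0_norm t0) ler_wpM2l.
Qed.
End estimator.

Theorem mainTheorem3 (R : realType) (d : measure_display)
    (Omega : measurableType d) (P : probability Omega R)
    (W xi : R -> {RV P >-> R}) (theta h : R)
    (theta0 : 0 < theta) (h0 : 0 < h)
    (hW : standard_wiener W) (hxi : ornstein_uhlenbeck W theta xi) :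
  {ae P, forall w,
    `|rho h0 theta - rho h0 (mle (fun t => xi t w) (n%:R * h))|
      @[n --> \oo] --> (0 : R)}.
Proof.
apply: filterS3 (ou_continuous hxi) (ou_endpoint_ae h hW theta0 hxi)
  (ou_time_average_ae hW theta0 h0 hxi) => w cw endw avgw.
have mlec := cvg_mle theta0 h0 cw endw avgw.
apply/cvgrPdist_le => e e0.
have eh : 0 < e / h by rewrite divr_gt0.
have /cvgrPdist_le/(_ _ eh) mle_e := mlec.
(* The Lipschitz bound on [rho] requires nonnegative parameters, while the estimator may be negative
   for some [n]. Being eventually within [theta] of its limit makes it eventually nonnegative. *)
have /cvgrPdist_le/(_ _ theta0) mle_t := mlec.
near=> n; rewrite sub0r normrN normr_id.
apply: le_trans (norm_rhoB_le _ (ltW theta0) _) _.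
  have : `|theta - mle (fun t => xi t w) (n%:R * h)| <= theta by near: n.
  by rewrite ler_norml; lra.
by rewrite -ler_pdivlMr//; near: n.
Unshelve. all: by end_near.
Qed.
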